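(* Let $(G,\cdot,\rhd)$ be a post-Lie group, let $(\mathfrak{g},[\cdot,\cdot]_{\mathfrak{g}})$ be the Lie algebra of the Lie group $(G,\cdot)$ with exponential map $\exp:\mathfrak{g}\to G$, and define $\triangleright:\mathfrak{g}\otimes\mathfrak{g}\to\mathfrak{g}$ by $$x\triangleright y=\frac{d}{dt}\Big|_{t=0}\frac{d}{ds}\Big|_{s=0}\exp(tx)\rhd\exp(sy)\qquad(x,y\in\mathfrak{g}).$$ Then $(\mathfrak{g},[\cdot,\cdot]_{\mathfrak{g}},\triangleright)$ is a post-Lie algebra. If $\Psi$ is a homomorphism of post-Lie groups from $(G,\cdot_G,\rhd_G)$ to $(H,\cdot_H,\rhd_H)$, then $\psi:=\Psi_{*e_G}$ is a homomorphism of the differentiated post-Lie algebras from $(\mathfrak{g},[\cdot,\cdot]_{\mathfrak{g}},\triangleright_{\mathfrak{g}})$ to $(\mathfrak{h},[\cdot,\cdot]_{\mathfrak{h}},\triangleright_{\mathfrak{h}})$. Furthermore, these correspondences give a functor from the category of post-Lie groups to the category of post-Lie algebras.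
   Context: The base field is $\mathbb{R}$. A post-group $(G,\cdot,\rhd)$ is a group $(G,\cdot)$ with a binary operation $\rhd$ on $G$ such that (1) for each $a\in G$ the map $L^\rhd_a:b\mapsto a\rhd b$ is an automorphism of $(G,\cdot)$; (2) $(a\cdot(a\rhd b))\rhd c=a\rhd(b\rhd c)$ for all $a,b,c\in G$. A post-Lie group is a post-group $(G,\cdot,\rhd)$ such that $(G,\cdot)$ is a Lie group and $\rhd:G\times G\to G$ is smooth. Homomorphisms of post-Lie groups are smooth maps preserving $\cdot$ and $\rhd$. The inner derivative in the definition of $\triangleright$ is $(L^\rhd_{\exp(tx)})_{*e}(y)\in\mathfrak{g}$; equivalently $x\triangleright y=L^\rhd_{*e}(x)(y)$, where $L^\rhd:G\to\mathrm{Aut}(\mathfrak{g})$, $a\mapsto(L^\rhd_a)_{*e}$, and $L^\rhd_{*e}:\mathfrak{g}\to\mathrm{Der}(\mathfrak{g})$ is its differential at $e$. The bracket convention is $[u,v]_{\mathfrak{g}}=\frac{d^2}{dt\,ds}\big|_{t,s=0}\exp(tu)\exp(sv)\exp(-tu)$. A post-Lie algebra $(\mathfrak{g},[\cdot,\cdot]_{\mathfrak{g}},\triangleright)$ is a Lie algebra with a bilinear operation $\triangleright$ such that for all $x,y,z$: $x\triangleright[y,z]_{\mathfrak{g}}=[x\triangleright y,z]_{\mathfrak{g}}+[y,x\triangleright z]_{\mathfrak{g}}$ and $([x,y]_{\mathfrak{g}}+x\triangleright y-y\triangleright x)\triangleright z=x\triangleright(y\triangleright z)-y\triangleright(x\triangleright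 z)$. A homomorphism of post-Lie algebras is a Lie algebra homomorphism preserving $\triangleright$. *)

(* Defs.v *)
From HB Require Import structures.
From mathcomp Require Import all_boot all_order all_algebra.
From mathcomp Require Import all_classical all_reals all_analysis.
Import Order.TTheory GRing.Theory Num.Theory numFieldNormedType.Exports.

Set Implicit Arguments.
Unset Strict Implicit.
Unset Printing Implicit Defensive.

Local Open Scope classical_set_scope.
Local Open Scope ring_scope.

(* C^k and C^oo functions on an open subset [U] of a finite-dimensional space. *)

Fixpoint ck_on (R : realType) (V W : normedModType R) (k : nat) (U : set V)
    (f : V -> W) : Prop :=
  if k is k'.+1 then
    (forall x, U x -> differentiable f x) /\
    (forall v : V, ck_on k' U (fun x => 'D_v f x))
  else forall x, U x -> {for x, continuous f}.

Definition smooth_on (R : realType) (V W : normedModType R) (U : set V)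
  (f : V -> W) : Prop := forall k, ck_on k U f.

Section CkTheory.
Variable R : realType.
Implicit Types V W : normedModType R.

Lemma ck_on_local V W k (U : set V) (f : V -> W) :
  (forall x, U x -> exists2 D : set V, D x & ck_on k D f) -> ck_on k U f.
Proof.
elim: k f => [|k IH] f H /=; first by move=> x /H[D Dx]; apply.
split=> [x /H [D Dx [fd _]] | v]; first exact: fd.
by apply: IH => x /H [D Dx [_ /(_ v) dv]]; exists D.
Qed.

Lemma ck_on_sub V W k (U D : set V) (f : V -> W) :
  U `<=` D -> ck_on k D f -> ck_on k U f.
Proof. by move=> UD Df; apply: ck_on_local => x /UD; exists D. Qed.

Lemma ckS_on V W k (U : set V) (f : V -> W) : ck_on k.+1 U f -> ck_on k U f.
Proof.
elim: k f => [|k IH] f [fd dvf].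
  by move=> x /fd; exact: differentiable_continuous.
by split=> // v; apply: IH; exact: dvf.
Qed.

Lemma near_eq_differentiable V W (f g : V -> W) x :
  (\near x, f x = g x) -> differentiable f x -> differentiable g x.
Proof.
move=> fg /diff_locallyP[dfc fE].
have gE : g \o shift x = cst (g x) + 'd f x +o_ 0 id.
  apply/eqaddoP => e e0.
  move/eqaddoP : fE => /(_ e e0) fE.
  have fg0 : \forall y \near (0 : V), f (x + y) = g (x + y).
    exact: (nbhs0P (fun y => f y = g y) x).1 fg.
  have fgx := nbhs_singleton fg.
  near=> y.
  have -> : (g \o shift x - (cst (g x) + 'd f x)) y =
            (f \o shift x - (cst (f x) + 'd f x)) y.
    rewrite /= !fctE /= fgx; congr (_ - _); rewrite addrC; apply/esym.
    by near: y.
  by near: y.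
have dE := diff_unique dfc gE.
by apply/diff_locallyP; rewrite dE.
Unshelve. all: by end_near. Qed.

Lemma ck_on_eq V W k (U : set V) (f g : V -> W) : open U ->
  (forall x, U x -> f x = g x) -> ck_on k U f -> ck_on k U g.
Proof.
move=> oU; elim: k f g => [|k IH] f g fg /=.
  move=> fc x Ux.
  have fgn : \near x, f x = g x by apply: filterS (open_nbhs_nbhs (conj oU Ux)) => y /fg.
  rewrite /prop_for /continuous_at -(fg _ Ux).
  by apply: cvg_trans (fc x Ux); exact: near_eq_cvg.
move=> [fd dvf].
have fgn x : U x -> \near x, f x = g x.
  by move=> Ux; apply: filterS (open_nbhs_nbhs (conj oU Ux)) => y /fg.
split=> [x Ux|v]; first exact: near_eq_differentiable (fgn x Ux) (fd x Ux).
by apply: IH (dvf v) => x /fgn; exact: near_eq_derive.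
Qed.

Lemma ck_on_cst V W k (U : set V) (c : W) : ck_on k U (fun=> c).
Proof.
elim: k c => [|k IH] c /=; first by move=> x _; exact: cvg_cst.
split=> [x _|v]; first exact: differentiable_cst.
under eq_fun do rewrite derive_cst.
exact: IH.
Qed.

Lemma ck_onD V W k (U : set V) (f g : V -> W) : open U ->
  ck_on k U f -> ck_on k U g -> ck_on k U (f \+ g).
Proof.
move=> oU; elim: k f g => [|k IH] f g /=.
  by move=> fc gc x Ux; apply: continuousD; [exact: fc|exact: gc].
move=> [fd dvf] [gd dvg]; split=> [x Ux|v].
  by apply: differentiableD; [exact: fd|exact: gd].
apply: (ck_on_eq oU _ (IH _ _ (dvf v) (dvg v))) => x Ux.
by rewrite deriveD//; apply: diff_derivable; [exact: fd|exact: gd].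
Qed.

Lemma ck_on_sum V W k (U : set V) n (f : 'I_n -> V -> W) : open U ->
  (forall i, ck_on k U (f i)) -> ck_on k U (fun x => \sum_(i < n) f i x).
Proof.
move=> oU; elim: n f => [|n IH] f fk.
  by under eq_fun do rewrite big_ord0; exact: ck_on_cst.
under eq_fun do rewrite big_ord_recr/=.
exact: (ck_onD oU (IH _ (fun i => fk (widen_ord (leqnSn n) i))) (fk ord_max)).
Qed.

Definition scale_pair W (a : R) (w : W) : W := a *: w.

Lemma scale_pair_bilinear W :
  bilinear_for (GRing.Scale.Law.clone _ _ *:%R _)
    (GRing.Scale.Law.clone _ _ *:%R _) (@scale_pair W).
Proof.
split=> [w a x y|a c x y]; rewrite /scale_pair /=.
- by rewrite scalerDl -scalerA.
- by rewrite scalerDr !scalerA mulrC.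
Qed.

HB.instance Definition _ W := bilinear_isBilinear.Build R R W W _ _
  (@scale_pair W) (@scale_pair_bilinear W).

Lemma diff_scale V W (a : V -> R) (f : V -> W) x :
  differentiable a x -> differentiable f x ->
  differentiable (fun y => a y *: f y) x /\
  forall v, 'D_v (fun y => a y *: f y) x = a x *: 'D_v f x + 'D_v a x *: f x.
Proof.
move=> da df.
pose s := fun p : R * W => scale_pair p.1 p.2.
have sc : continuous s by move=> p; exact: scale_continuous.
have ds p : differentiable s p by exact: differentiable_bilin.
have dp : differentiable (fun y => (a y, f y)) x by exact: differentiable_pair.
have E : (fun y => a y *: f y) = s \o (fun y => (a y, f y)) by [].
have dd : differentiable (fun y => a y *: f y) x.
  by rewrite E; exact: differentiable_comp.
split=> // v; rewrite !deriveE// E diff_comp//= diff_pair//= /s.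
by rewrite diff_bilin.
Qed.

Lemma ck_onZ V W k (U : set V) (a : V -> R) (f : V -> W) : open U ->
  ck_on k U a -> ck_on k U f -> ck_on k U (fun x => a x *: f x).
Proof.
move=> oU; elim: k a f => [|k IH] a f.
  by move=> ac fc x Ux; apply: continuousZ; [exact: ac|exact: fc].
move=> ak fk; have [ad dva] := ak; have [fd dvf] := fk.
split=> [x Ux|v]; first by have [] := diff_scale (ad x Ux) (fd x Ux).
apply: (ck_on_eq oU _ (ck_onD oU (IH _ _ (ckS_on ak) (dvf v))
  (IH _ _ (dva v) (ckS_on fk)))) => x Ux.
by have [_ ->] := diff_scale (ad x Ux) (fd x Ux).
Qed.

Lemma ck_on_coord V n k (U : set V) (f : V -> 'rV[R]_n) i : open U ->
  ck_on k U f -> ck_on k U (fun x => f x 0 i : R).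
Proof.
move=> oU; elim: k f => [|k IH] f.
  move=> fc x Ux; apply: (@continuous_comp _ _ _ f (fun A : 'rV[R]_n => A 0 i : R)).
      exact: fc.
    exact: coord_continuous.
move=> [fd dvf]; split=> [x Ux|v].
  apply: (@differentiable_comp _ _ _ _ f (fun M : 'rV[R]_n => M 0 i : R)).
    exact: fd.
  exact: differentiable_coord.
apply: (ck_on_eq oU _ (IH _ (dvf v))) => x Ux.
pose L := fun M : 'rV[R]_n => M 0 i : R.
have lL : linear L by move=> a u w; rewrite /L !mxE.
pose Lm : {linear _ -> _} := HB.pack L (GRing.isLinear.Build _ _ _ _ L lL).
have cL : continuous Lm by exact: coord_continuous.
have dc : differentiable Lm (f x) by exact: linear_differentiable.
have fx := fd x Ux.
have dLf : differentiable (Lm \o f) x by exact: differentiable_comp.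
transitivity ('D_v (Lm \o f) x); last by [].
rewrite !deriveE//.
have -> : 'd (Lm \o f) x = 'd Lm (f x) \o 'd f x :> (V -> R) by exact: diff_comp.
by rewrite (diff_lin _ cL).
Qed.

Lemma ck_on_comp V n W k (U : set V) (D : set 'rV[R]_n) (f : V -> 'rV[R]_n)
    (g : 'rV[R]_n -> W) : open U -> U `<=` f @^-1` D ->
  ck_on k U f -> ck_on k D g -> ck_on k U (g \o f).
Proof.
move=> oU UD; elim: k g => [|k IH] g.
  by move=> fc gc x Ux; apply: continuous_comp; [exact: fc|exact/gc/UD].
move=> fk [gd dvg]; have [fd dvf] := fk.
have dgf x : U x -> differentiable (g \o f) x.
  by move=> Ux; apply: differentiable_comp; [exact: fd|exact/gd/UD].
split=> // v.
have dk i := ck_onZ oU (ck_on_coord i oU (dvf v))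
  (IH _ (ckS_on fk) (dvg (delta_mx 0 i))).
apply: (ck_on_eq oU _ (ck_on_sum oU dk)) => x Ux /=.
have fx := fd x Ux; have gx := gd _ (UD x Ux).
rewrite [RHS](deriveE _ (dgf x Ux)) diff_comp//= -(deriveE v fx).
rewrite [in RHS](row_sum_delta ('D_v f x)) linear_sum.
by apply: eq_bigr => i _; rewrite linearZ /= -(deriveE _ gx).
Qed.

End CkTheory.

(* Charts are stored as total functions; [cfun] and [cinv] are meaningful on
   [cdom] and on its image only. *)

Record chart (R : realType) (M : topologicalType) (E : normedModType R) :=
  Chart { cdom : set M; cfun : M -> E; cinv : E -> M }.

Definition cimg (R : realType) (M : topologicalType) (E : normedModType R)
  (c : chart M E) : set E := cfun c @` cdom c.

Definition is_chart (R : realType) (M : topologicalType)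
    (E : normedModType R) (c : chart M E) : Prop :=
  [/\ open (cdom c), open (cimg c),
      {in cdom c, cancel (cfun c) (cinv c)},
      {in cdom c, continuous (cfun c)} &
      {in cimg c, continuous (cinv c)}].

(* An atlas is given as a family of charts indexed by the points, [A x] being
   a chart around [x]: besides the atlas, this selects at every point the
   chart in which tangent vectors at that point are written. *)

Definition is_smooth_atlas (R : realType) (M : topologicalType)
    (E : normedModType R) (A : M -> chart M E) : Prop :=
  [/\ forall x, is_chart (A x),
      forall x, cdom (A x) x &
      forall x y, smooth_on (cfun (A x) @` (cdom (A x) `&` cdom (A y)))
                            (cfun (A y) \o cinv (A x))].

Definition smooth_map (R : realType) (M N : topologicalType)
    (E F : normedModType R) (A : M -> chart M E) (B : N -> chart N F)
    (f : M -> N) : Prop :=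
  continuous f /\
  forall x y,
    smooth_on (cfun (A x) @` (cdom (A x) `&` f @^-1` cdom (B y)))
              (cfun (B y) \o f \o cinv (A x)).

Definition line_atlas (R : realType) (x : R) : chart R R :=
  Chart setT id id.

Definition prod_atlas (R : realType) (M N : topologicalType)
    (E F : normedModType R) (A : M -> chart M E) (B : N -> chart N F)
    (p : M * N) : chart (M * N)%type (E * F)%type :=
  Chart (cdom (A p.1) `*` cdom (B p.2))
        (fun q => (cfun (A p.1) q.1, cfun (B p.2) q.2))
        (fun q => (cinv (A p.1) q.1, cinv (B p.2) q.2)).

Lemma open_cfun_image (R : realType) (M : topologicalType)
    (E : normedModType R) (c : chart M E) (B : set M) :
  is_chart c -> open B -> open (cfun c @` (cdom c `&` B)).
Proof.
move=> [oc oi cK cc ci] oB.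
have -> : cfun c @` (cdom c `&` B) = cimg c `&` cinv c @^-1` B.
  apply/seteqP; split=> [_ [x [cx Bx] <-]|_ [[x cx <-] Bx]].
    split; first by exists x.
    by rewrite /preimage /= cK// inE.
  by exists x => //; split=> //; move: Bx; rewrite /preimage/= cK// inE.
rewrite openE => y [iy By]; apply: filterI; first exact: open_nbhs_nbhs.
by apply: (ci y); [rewrite inE|exact: open_nbhs_nbhs].
Qed.

Lemma smooth_map_comp (R : realType) (M N P : topologicalType)
    (E G : normedModType R) (n : nat)
    (A : M -> chart M E) (B : N -> chart N 'rV[R]_n) (C : P -> chart P G)
    (g : N -> P) (f : M -> N) :
  is_smooth_atlas A -> is_smooth_atlas B -> is_smooth_atlas C ->
  smooth_map A B f -> smooth_map B C g -> smooth_map A C (g \o f).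
Proof.
move=> [Ac _ _] [Bc Bx _] [Cc _ _] [fc fs] [gc gs].
split=> [x|x z]; first by apply: continuous_comp; [exact: fc|exact: gc].
move=> k; apply: ck_on_local => _ [p [Ap Cp] <-].
have [_ _ AK _ _] := Ac x.
pose y := f p; have [oB _ BK _ _] := Bc y; have [oC _ _ _ _] := Cc z.
pose Q := f @^-1` (cdom (B y) `&` g @^-1` cdom (C z)).
exists (cfun (A x) @` (cdom (A x) `&` Q)).
  by exists p => //; split=> //; split=> //; exact: Bx.
have oQ : open (cfun (A x) @` (cdom (A x) `&` Q)).
  apply: open_cfun_image => //; move/continuousP : fc; apply.
  by apply: openI => //; move/continuousP : gc; apply.
apply: (ck_on_eq oQ _ (ck_on_comp oQ _ (ck_on_sub _ (fs x y k)) (gs y z k))).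
- by move=> _ [q [Aq [Bq Cq]] <-] /=; rewrite AK ?inE// BK ?inE.
- move=> _ [q [Aq [Bq Cq]] <-]; exists (f q); first by split.
  by rewrite /= AK ?inE.
- by move=> _ [q [Aq [Bq Cq]] <-]; exists q.
Qed.

Lemma smooth_map_id (R : realType) (M : topologicalType)
    (E : normedModType R) (A : M -> chart M E) :
  is_smooth_atlas A -> smooth_map A A id.
Proof. by move=> [_ _ tr]; split=> [x|x y]; [exact: cvg_id|exact: tr]. Qed.

HB.mixin Record isSmoothManifold (R : realType) M of Topological M := {
  mfd_dim : nat;
  mfd_chart : M -> chart M 'rV[R]_mfd_dim;
  mfd_chartP : is_smooth_atlas mfd_chart;
  mfd_hausdorff : hausdorff_space M;
  mfd_second_countable : @second_countable M
}.

#[short(type="smoothManifoldType")]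
HB.structure Definition SmoothManifold (R : realType) :=
  {M of isSmoothManifold R M & Topological M}.

HB.mixin Record isLieGroup (R : realType) G
    of SmoothManifold R G & Group G := {
  mulg_smooth :
    smooth_map (prod_atlas (@mfd_chart R G) (@mfd_chart R G)) (@mfd_chart R G)
      (fun p : G * G => (p.1 * p.2)%g);
  invg_smooth :
    smooth_map (@mfd_chart R G) (@mfd_chart R G) (fun a : G => a^-1%g)
}.

#[short(type="lieGroupType")]
HB.structure Definition LieGroup (R : realType) :=
  {G of isLieGroup R G & SmoothManifold R G & Group G}.

HB.mixin Record isPostGroup G of Group G := {
  rhd : G -> G -> G;
  rhd_bij : forall a, bijective (rhd a);
  rhdM : forall a, {morph rhd a : b c / (b * c)%g};
  rhdA : forall a b c, rhd (a * rhd a b)%g c = rhd a (rhd b c)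
}.

#[short(type="postGroupType")]
HB.structure Definition PostGroup := {G of isPostGroup G & Group G}.

HB.mixin Record isPostLieGroup (R : realType) G
    of LieGroup R G & PostGroup G := {
  rhd_smooth :
    smooth_map (prod_atlas (@mfd_chart R G) (@mfd_chart R G)) (@mfd_chart R G)
      (fun p : G * G => rhd p.1 p.2)
}.

#[short(type="postLieGroupType")]
HB.structure Definition PostLieGroup (R : realType) :=
  {G of isPostLieGroup R G & LieGroup R G & PostGroup G}.

Definition is_post_lie_group_hom (R : realType) (G H : postLieGroupType R)
    (Psi : G -> H) : Prop :=
  [/\ smooth_map (@mfd_chart R G) (@mfd_chart R H) Psi,
      {morph Psi : a b / (a * b)%g} &
      {morph Psi : a b / rhd a b}].

Arguments mfd_dim {R} M : rename.

(* The tangent space at a point [x], in the coordinates of [mfd_chart x]. *)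
Notation tangent M := 'rV[_]_(mfd_dim M).

Definition tangent_map (R : realType) (M N : smoothManifoldType R)
    (f : M -> N) (x : M) : tangent M -> tangent N :=
  'd (cfun (mfd_chart (f x)) \o f \o cinv (mfd_chart x))
     (cfun (mfd_chart x) x).

Section LieAlgebraOfLieGroup.
Variables (R : realType) (G : lieGroupType R).

(* The velocity at time 0 of a curve through the unit. *)
Definition velocity1 (c : R -> G) : tangent G :=
  derive1 (cfun (mfd_chart (1%g : G)) \o c) 0.

Definition one_parameter_subgroup (c : R -> G) : Prop :=
  smooth_map (@line_atlas R) (@mfd_chart R G) c /\
  forall s t, c (s + t) = (c s * c t)%g.

(* [exp x = c 1] for the one-parameter subgroup [c] with initial velocity [x];
   it exists and is unique, so the default value [1] is never used. *)
Definition lie_exp (x : tangent G) : G :=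
  xget 1%g [set g | exists c : R -> G,
    [/\ one_parameter_subgroup c, velocity1 c = x & c 1 = g]].

(* d/dt d/ds at t = s = 0 of exp(tx) exp(sy) exp(-tx): for fixed t the inner
   curve starts at the unit, so its velocity lies in the tangent space there,
   and the outer derivative is taken in that vector space. Similarly for
   [post_lie_product]. *)
Definition lie_bracket (x y : tangent G) : tangent G :=
  derive1 (fun t : R => velocity1 (fun s : R =>
     (lie_exp (t *: x) * lie_exp (s *: y) * lie_exp (- t *: x))%g)) 0.

End LieAlgebraOfLieGroup.

Definition post_lie_product (R : realType) (G : postLieGroupType R)
    (x y : tangent G) : tangent G :=
  derive1 (fun t : R => velocity1 (fun s : R =>
     rhd (lie_exp (t *: x)) (lie_exp (s *: y)))) 0.

Definition is_bilinear (R : realType) (g : lmodType R) (op : g -> g -> g) :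
  Prop := (forall x, linear (op x)) /\ (forall y, linear (op^~ y)).

Definition is_lie_algebra (R : realType) (g : lmodType R)
    (br : g -> g -> g) : Prop :=
  [/\ is_bilinear br,
      forall x, br x x = 0 &
      forall x y z, br x (br y z) + br y (br z x) + br z (br x y) = 0].

Definition is_post_lie_algebra (R : realType) (g : lmodType R)
    (br tri : g -> g -> g) : Prop :=
  [/\ is_lie_algebra br,
      is_bilinear tri,
      forall x y z, tri x (br y z) = br (tri x y) z + br y (tri x z) &
      forall x y z, tri (br x y + tri x y - tri y x) z =
                    tri x (tri y z) - tri y (tri x z)].

Definition is_post_lie_algebra_hom (R : realType) (g h : lmodType R)
    (brg trig : g -> g -> g) (brh trih : h -> h -> h) (f : g -> h) : Prop :=
  [/\ linear f,
      {morph f : x y / brg x y >-> brh x y} &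
      {morph f : x y / trig x y >-> trih x y}].

Record category := Category {
  obj :> Type;
  hom : obj -> obj -> Type;
  idm : forall a, hom a a;
  comp : forall a b c, hom b c -> hom a b -> hom a c;
  comp1m : forall a b (f : hom a b), comp (idm b) f = f;
  compm1 : forall a b (f : hom a b), comp f (idm a) = f;
  compmA : forall a b c d (h : hom c d) (g : hom b c) (f : hom a b),
    comp h (comp g f) = comp (comp h g) f
}.

Definition is_functor (C D : category) (Fo : C -> D)
    (Fm : forall a b : C, hom a b -> hom (Fo a) (Fo b)) : Prop :=
  (forall a : C, Fm a a (idm a) = idm (Fo a)) /\
  (forall (a b c : C) (g : hom b c) (f : hom a b),
     Fm a c (comp g f) = comp (Fm b c g) (Fm a b f)).

Section PostLieGroups.
Variable R : realType.

Record postLieGroupHom (G H : postLieGroupType R) := PostLieGroupHom {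
  plg_fun :> G -> H;
  plg_funP : is_post_lie_group_hom plg_fun
}.

Lemma plg_hom_eq (G H : postLieGroupType R) (f g : postLieGroupHom G H) :
  plg_fun f = plg_fun g -> f = g.
Proof.
case: f g => [f fP] [g gP] /= fg; move: fP gP.
by rewrite fg => fP gP; congr PostLieGroupHom; exact: Prop_irrelevance.
Qed.

Lemma plg_idP (G : postLieGroupType R) : is_post_lie_group_hom (@id G).
Proof. by split=> //; apply: smooth_map_id; exact: mfd_chartP. Qed.

Lemma plg_compP (G H K : postLieGroupType R) (g : postLieGroupHom H K)
  (f : postLieGroupHom G H) : is_post_lie_group_hom (g \o f).
Proof.
have [sg gM gr] := plg_funP g; have [sf fM fr] := plg_funP f.
split=> [|a b|a b] /=; last 2 first.
- by rewrite fM gM.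
- by rewrite fr gr.
by apply: smooth_map_comp sf sg; exact: mfd_chartP.
Qed.

Definition PostLieGroups : category.
refine (@Category (postLieGroupType R) postLieGroupHom
  (fun G => PostLieGroupHom (plg_idP G))
  (fun G H K g f => PostLieGroupHom (plg_compP g f)) _ _ _).
- by move=> a b f; exact: plg_hom_eq.
- by move=> a b f; exact: plg_hom_eq.
- by move=> a b c d h g f; exact: plg_hom_eq.
Defined.

End PostLieGroups.

Section PostLieAlgebras.
Variable R : realType.

Record postLieAlgebra := PostLieAlgebra {
  pla_sort :> lmodType R;
  pla_bracket : pla_sort -> pla_sort -> pla_sort;
  pla_product : pla_sort -> pla_sort -> pla_sort;
  pla_axioms : is_post_lie_algebra pla_bracket pla_product
}.

Record postLieAlgebraHom (g h : postLieAlgebra) := PostLieAlgebraHom {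
  pla_fun :> g -> h;
  pla_funP : is_post_lie_algebra_hom (@pla_bracket g) (@pla_product g)
    (@pla_bracket h) (@pla_product h) pla_fun
}.

Lemma pla_hom_eq (g h : postLieAlgebra) (f f' : postLieAlgebraHom g h) :
  pla_fun f = pla_fun f' -> f = f'.
Proof.
case: f f' => [f fP] [f' fP'] /= ff; move: fP fP'.
by rewrite ff => fP fP'; congr PostLieAlgebraHom; exact: Prop_irrelevance.
Qed.

Lemma pla_idP (g : postLieAlgebra) :
  is_post_lie_algebra_hom (@pla_bracket g) (@pla_product g)
    (@pla_bracket g) (@pla_product g) id.
Proof. by split. Qed.

Lemma pla_compP (g h k : postLieAlgebra) (f' : postLieAlgebraHom h k)
    (f : postLieAlgebraHom g h) :
  is_post_lie_algebra_hom (@pla_bracket g) (@pla_product g)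
    (@pla_bracket k) (@pla_product k) (f' \o f).
Proof.
have [l' b' t'] := pla_funP f'; have [l b t] := pla_funP f.
split=> [a x y|x y|x y] /=; first by rewrite l l'.
- by rewrite b b'.
- by rewrite t t'.
Qed.

Definition PostLieAlgebras : category.
refine (@Category postLieAlgebra postLieAlgebraHom
  (fun g => PostLieAlgebraHom (pla_idP g))
  (fun g h k f' f => PostLieAlgebraHom (pla_compP f' f)) _ _ _).
- by move=> a b f; exact: pla_hom_eq.
- by move=> a b f; exact: pla_hom_eq.
- by move=> a b c d h g f; exact: pla_hom_eq.
Defined.

End PostLieAlgebras.

(* Main.v *)
(** Every formula in the statement is the derivative at [a = 1] of the tangent
    map at [1] of an endomorphism [F(a, -)] of [G], with [F(a, b) = a b a^-1] for
    the bracket and [F(a, b) = a |> b] for the product. Such a derivative is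
    bilinear, being a mixed second derivative of [F] in the chart at [1], and it
    is natural in [(G, F)]. Naturality for the homomorphism [F(a, -)] itself says
    that it preserves the bracket; differentiating in [a] gives the Leibniz rule,
    which is the Jacobi identity for the conjugation and the first post-Lie axiom
    for [|>]. The second axiom comes from differentiating
    [A(a (a |> b)) = A(a) A(b)], where [A(a)] is the tangent map of [a |> -], first
    in [b] and then in [a], and antisymmetrizing: the second derivatives of [A]
    cancel by symmetry, and the second derivatives of the multiplication leave the
    bracket.

    All this only uses that [t |-> exp (t x)] is a one-parameter subgroup with
    velocity [x]; smoothness of [exp] is never needed. These subgroups are obtained
    from Picard's theorem applied to left-invariant vector fields; they are unique
    because a curve with zero logarithmic derivative is constant. *)

Require Import Defs.
From HB Require Import structures.
From mathcomp Require Import all_boot all_order all_algebra.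
From mathcomp Require Import all_classical all_reals all_analysis.
From mathcomp Require Import ring lra.
Import Order.TTheory GRing.Theory Num.Theory numFieldNormedType.Exports.

Set Implicit Arguments.
Unset Strict Implicit.
Unset Printing Implicit Defensive.

Local Open Scope classical_set_scope.
Local Open Scope ring_scope.

(** * Derivatives along curves and mixed partial derivatives *)

Section Calculus.
Variable R : realType.
Implicit Types V W X : normedModType R.

Lemma is_derive_comp_curve V W (h : V -> W) (p : R -> V) t v :
  differentiable h (p t) -> is_derive t 1 p v ->
  is_derive t 1 (h \o p) ('D_v h (p t)).
Proof.
move=> dh [dp <-].
have dp' : differentiable p t by exact/derivable1_diffP.
have dhp : differentiable (h \o p) t by exact: differentiable_comp.
apply: DeriveDef; first exact/derivable1_diffP.
by rewrite deriveE// diff_comp//= -!deriveE//.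
Qed.

Lemma is_derive_line V (p u : V) (t : R) :
  is_derive t 1 (fun s : R => p + s *: u) u.
Proof.
have du : is_derive t 1 ( *:%R^~ u : R -> V) u.
  apply: DeriveDef; first exact/derivable1_diffP.
  by rewrite deriveE// diff_val scale1r.
by rewrite -[u in X in is_derive _ _ _ X]add0r; exact: is_deriveD.
Qed.

Lemma mvt_incr (g dg : R -> R) (h : R) : 0 < h ->
  (forall s, 0 <= s <= h -> is_derive s 1 g (dg s)) ->
  exists2 c, 0 < c < h & g h - g 0 = h * dg c.
Proof.
move=> h0 gd.
have [||c] := @MVT _ g dg 0 h h0.
- by move=> s; rewrite in_itv/= => /andP[s0 sh]; apply: gd; rewrite !ltW.
- apply: derivable_within_continuous => s; rewrite in_itv/= => sh.
  by have [] := gd _ sh.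
rewrite in_itv/= subr0 => ch ->; exists c => //; exact: mulrC.
Qed.

(* The second difference is symmetric in [u] and [v]: this is what makes the
   mixed derivatives commute. *)
Lemma second_difference V (U : set V) (f : V -> R) (u v x : V) (e : R) :
  open U -> ck_on 2 U f -> U x -> 0 < e ->
  \forall h \near 0^'+, exists2 y,
    `|'D_v (fun z => 'D_u f z) y - 'D_v (fun z => 'D_u f z) x| < e &
    f (x + h *: u + h *: v) - f (x + h *: u) - f (x + h *: v) + f x =
    h * (h * 'D_v (fun z => 'D_u f z) y).
Proof.
move=> oU [fd dfd] Ux e0.
have [dfdd ddf] := dfd u.
pose D := 'D_v (fun z => 'D_u f z).
have cD : {for x, continuous D} by exact: ddf.
(* The radius [d] keeps the whole small parallelogram at [x] inside [U], with the mixed derivative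
   within [e] of its value at [x]. *)
have [d d0 dP] : exists2 d : R, 0 < d & forall s t, 0 <= s < d -> 0 <= t < d ->
    U (x + s *: u + t *: v) /\ `|D (x + s *: u + t *: v) - D x| < e.
  pose P (z : R * R) := x + z.1 *: u + z.2 *: v.
  have cP : {for 0, continuous P}.
    apply: continuousD; first apply: continuousD; first exact: cvg_cst.
      by apply: continuousZr_tmp; exact: cvg_fst.
    by apply: continuousZr_tmp; exact: cvg_snd.
  have : \forall z \near (0 : R * R), U (P z) /\ `|D (P z) - D x| < e.
    have P0 : P 0 = x by rewrite /P !scale0r !addr0.
    apply: (cP (fun y => U y /\ `|D y - D x| < e)); rewrite P0.
    apply: filterI; first exact: open_nbhs_nbhs.
    by move/cvgr_distC_lt : cD; exact.
  move=> /nbhs_ballP[d /= d0 dP]; exists d => // s t /andP[s0 sd] /andP[t0 td].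
  apply: (dP (s, t)); rewrite -ball_normE /= sub0r normrN.
  by rewrite prod_normE /= gt_max !ger0_norm// sd td.
near=> h.
have h0 : 0 < h by [].
have hd : h < d by near: h; exact: nbhs_right_lt.
have lin p w s : U (p + s *: w) ->
    is_derive s 1 (fun r : R => f (p + r *: w)) ('D_w f (p + s *: w)).
  move=> Uw; apply: (is_derive_comp_curve (h := f) (p := fun r : R => p + r *: w)).
    exact: fd.
  exact: is_derive_line.
have Uh s : 0 <= s <= h -> U (x + s *: u + h *: v).
  by move=> /andP[s0 sh]; apply: (dP _ _ _ _).1; rewrite ?s0 ?(le_lt_trans sh)// ltW.
have U0 s t : 0 <= s <= h -> 0 <= t <= h -> U (x + s *: u + t *: v).
  move=> /andP[s0 sh] /andP[t0 th].
  by apply: (dP _ _ _ _).1; rewrite ?s0 ?t0 ?(le_lt_trans sh)// (le_lt_trans th).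
have addsv s : x + s *: u + h *: v = (x + h *: v) + s *: u by rewrite addrAC.
(* The mean value theorem in the direction [u], for the difference of [f] along the two opposite
   sides of the parallelogram. *)
have [||c /andP[c0 ch] cE] := @mvt_incr
  (fun s => f ((x + h *: v) + s *: u) - f (x + s *: u))
  (fun s => 'D_u f ((x + h *: v) + s *: u) - 'D_u f (x + s *: u)) h.
- by [].
- move=> s sh; apply: is_deriveB; apply: lin.
    by rewrite -addsv; exact: Uh.
  by have := U0 s 0 sh; rewrite scale0r addr0; apply; rewrite lexx ltW.
(* The mean value theorem in the direction [v], for ['D_u f] on the segment starting at
   [x + c *: u]. *)
have [||b /andP[b0 bh] bE] := @mvt_incr
  (fun t => 'D_u f (x + c *: u + t *: v))
  (fun t => D (x + c *: u + t *: v)) h.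
- by [].
- move=> t th.
  apply: (is_derive_comp_curve (h := fun z => 'D_u f z)
    (p := fun r : R => x + c *: u + r *: v)); last exact: is_derive_line.
  by apply: dfdd; apply: U0 => //; rewrite !ltW.
exists (x + c *: u + b *: v).
  by apply: (dP _ _ _ _).2; rewrite ?ltW//= (lt_trans _ hd).
move: cE bE; rewrite !scale0r !addr0 -!addsv => cE bE.
by rewrite bE in cE; rewrite -cE opprB addrA addrAC.
Unshelve. all: by end_near. Qed.

(** For one small [h], the two orders of the second difference give points [y1] and [y2] with equal
    mixed derivatives; each of these is within [e / 2] of one side of the equation. *)
Lemma schwarz V (U : set V) (f : V -> R) (u v x : V) :
  open U -> ck_on 2 U f -> U x ->
  'D_u (fun z => 'D_v f z) x = 'D_v (fun z => 'D_u f z) x.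
Proof.
move=> oU f2 Ux; apply/eqP; rewrite -subr_eq0 -normr_le0.
apply/ler_addgt0Pr => e e0; rewrite add0r.
have e20 : 0 < e / 2 by rewrite divr_gt0.
have A1 := second_difference u v oU f2 Ux e20.
have A2 := second_difference v u oU f2 Ux e20.
have [h [[y1 y1e E1] [[y2 y2e E2] /gt_eqF/negbT h0]]] :=
  filter_ex (filterI A1 (filterI A2 (nbhs_right_gt (0 : R)))).
have E : 'D_v (fun z => 'D_u f z) y1 = 'D_u (fun z => 'D_v f z) y2.
  have xE : x + h *: v + h *: u = x + h *: u + h *: v by exact: addrAC.
  have fE (a b c : R) : a - b - c = a - c - b by exact: addrAC.
  rewrite xE fE E1 in E2; exact: (mulfI h0 (mulfI h0 E2)).
rewrite (splitr e) -(subrKA ('D_u (fun z => 'D_v f z) y2)).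
apply: le_trans (ler_normD _ _) _.
apply: lerD; apply: ltW; first by rewrite distrC; exact: y2e.
by rewrite -E; exact: y1e.
Qed.

Lemma derive_coord V n (f : V -> 'rV[R]_n) x v i : derivable f x v ->
  'D_v f x 0 i = 'D_v (fun y => f y 0 i : R) x.
Proof. by move=> df; rewrite derive_mx// mxE. Qed.

Lemma schwarz_rV V n (U : set V) (f : V -> 'rV[R]_n) (u v x : V) :
  open U -> ck_on 2 U f -> U x ->
  'D_u (fun z => 'D_v f z) x = 'D_v (fun z => 'D_u f z) x.
Proof.
move=> oU f2 Ux; have [fd dfd] := f2.
apply/rowP => i.
have E w w' : 'D_w (fun z => 'D_w' f z) x 0 i =
              'D_w (fun z => 'D_w' (fun y => f y 0 i : R) z) x.
  have [dw' _] := dfd w'.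
  rewrite derive_coord; last exact/diff_derivable/dw'.
  apply: near_eq_derive; near=> z.
  rewrite derive_coord//; apply/diff_derivable/fd.
  by near: z; exact: open_nbhs_nbhs.
have S := schwarz u v oU (ck_on_coord i oU f2) Ux.
exact: (etrans (E u v) (etrans S (esym (E v u)))).
Unshelve. all: by end_near. Qed.

Lemma derive_pair V W1 W2 (f : V -> W1) (g : V -> W2) x v :
  differentiable f x -> differentiable g x ->
  'D_v (fun y => (f y, g y)) x = ('D_v f x, 'D_v g x).
Proof.
move=> df dg; have dfg := differentiable_pair df dg.
by rewrite !deriveE// diff_pair.
Qed.

Lemma ck_on_pair V W1 W2 k (U : set V) (f : V -> W1) (g : V -> W2) :
  open U -> ck_on k U f -> ck_on k U g -> ck_on k U (fun x => (f x, g x)).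
Proof.
move=> oU; elim: k f g => [|k IH] f g.
  by move=> fc gc x Ux; apply: cvg_pair; [exact: fc|exact: gc].
move=> [fd dvf] [gd dvg]; split=> [x Ux|v].
  by apply: differentiable_pair; [exact: fd|exact: gd].
apply: (ck_on_eq oU _ (IH _ _ (dvf v) (dvg v))) => x Ux.
by rewrite derive_pair//; [exact: fd|exact: gd].
Qed.

(** Since ['D_v L] is the constant [L' v], each ['D_v (g \o L)] is ['D_(L' v) g \o L], and the
    induction runs on [g] alone. The middle space is arbitrary, so products and the real line are
    covered. *)
Lemma ck_on_affine V W X k (U : set V) (D : set W) (L L' : V -> W) (g : W -> X) :
  open U -> U `<=` L @^-1` D ->
  (forall x v, differentiable L x /\ 'D_v L x = L' v) ->
  ck_on k D g -> ck_on k U (g \o L).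
Proof.
move=> oU UD dL; elim: k g => [|k IH] g.
  move=> gc x Ux; apply: continuous_comp; last exact/gc/UD.
  exact/differentiable_continuous/(dL x 0).1.
move=> [gd dvg].
have dgL x : U x -> differentiable (g \o L) x.
  move=> Ux; apply: differentiable_comp; last exact/gd/UD.
  exact: (dL x 0).1.
split=> // v; apply: (ck_on_eq oU _ (IH _ (dvg (L' v)))) => x Ux /=.
have [dLx <-] := dL x v; have gx := gd _ (UD x Ux).
by rewrite [RHS](deriveE _ (dgL x Ux)) diff_comp//= -(deriveE v dLx) -deriveE.
Qed.

(** Turns a derivative in a varying direction into a sum of derivatives in fixed directions with
    varying coefficients. Taking [linl] or [linr] for [L] gives the partial derivatives on a
    product. *)
Lemma derive_lincomb n V W (L : {linear 'rV[R]_n -> V}) (h : V -> W) x w :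
  differentiable h x ->
  'D_(L w) h x = \sum_i w 0 i *: 'D_(L (delta_mx 0 i)) h x.
Proof.
move=> dh; rewrite (deriveE _ dh) [in LHS](row_sum_delta w) !linear_sum.
by apply: eq_bigr => i _; rewrite !linearZ /= -(deriveE _ dh).
Qed.

Lemma linl_subproof n m : linear (fun w : 'rV[R]_n => (w, 0 : 'rV[R]_m)).
Proof.
by move=> a x y; apply: injective_projections; rewrite /= ?scaler0 ?addr0.
Qed.

Definition linl n m : {linear 'rV[R]_n -> ('rV[R]_n * 'rV[R]_m)%type} :=
  HB.pack (fun w : 'rV[R]_n => (w, 0 : 'rV[R]_m))
    (GRing.isLinear.Build _ _ _ _ _ (@linl_subproof n m)).

Lemma linr_subproof n m : linear (fun w : 'rV[R]_m => (0 : 'rV[R]_n, w)).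
Proof.
by move=> a x y; apply: injective_projections; rewrite /= ?scaler0 ?addr0.
Qed.

Definition linr n m : {linear 'rV[R]_m -> ('rV[R]_n * 'rV[R]_m)%type} :=
  HB.pack (fun w : 'rV[R]_m => (0 : 'rV[R]_n, w))
    (GRing.isLinear.Build _ _ _ _ _ (@linr_subproof n m)).

Lemma ck_on_comp2 V n m W k (U : set V) (D : set ('rV[R]_n * 'rV[R]_m))
    (f1 : V -> 'rV[R]_n) (f2 : V -> 'rV[R]_m) (g : 'rV[R]_n * 'rV[R]_m -> W) :
  open U -> (forall x, U x -> D (f1 x, f2 x)) ->
  ck_on k U f1 -> ck_on k U f2 -> ck_on k D g ->
  ck_on k U (fun x => g (f1 x, f2 x)).
Proof.
move=> oU UD; elim: k g => [|k IH] g.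
  move=> f1c f2c gc x Ux.
  apply: (@continuous_comp _ _ _ (fun x => (f1 x, f2 x)) g); last exact/gc/UD.
  exact: cvg_pair (f1c x Ux) (f2c x Ux).
move=> f1k f2k [gd dvg]; have [f1d dvf1] := f1k; have [f2d dvf2] := f2k.
have dp x : U x -> differentiable (fun x => (f1 x, f2 x)) x.
  by move=> Ux; apply: differentiable_pair; [exact: f1d|exact: f2d].
have dgf x : U x -> differentiable (g \o (fun x => (f1 x, f2 x))) x.
  by move=> Ux; apply: differentiable_comp; [exact: dp|exact/gd/UD].
split=> // v.
have dk1 i := ck_onZ oU (ck_on_coord i oU (dvf1 v))
  (IH _ (ckS_on f1k) (ckS_on f2k) (dvg (linl n m (delta_mx 0 i)))).
have dk2 i := ck_onZ oU (ck_on_coord i oU (dvf2 v))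
  (IH _ (ckS_on f1k) (ckS_on f2k) (dvg (linr n m (delta_mx 0 i)))).
apply: (ck_on_eq oU _ (ck_onD oU (ck_on_sum oU dk1) (ck_on_sum oU dk2))) => x Ux /=.
have gx := gd _ (UD x Ux).
rewrite [RHS](deriveE _ (dgf x Ux)) diff_comp//=; [|exact: dp].
rewrite -(deriveE v (dp x Ux)) derive_pair; [|exact: f1d|exact: f2d].
rewrite -(derive_lincomb (linl n m) _ gx) -(derive_lincomb (linr n m) _ gx).
rewrite !(deriveE _ gx) -linearD; congr ('d g _ _).
by congr pair; rewrite /= ?addr0 ?add0r.
Qed.

Lemma is_derive_scale W (a : R -> R) (f : R -> W) (t : R) a' f' :
  is_derive t 1 a a' -> is_derive t 1 f f' ->
  is_derive t 1 (fun s => a s *: f s) (a t *: f' + a' *: f t).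
Proof.
move=> [/derivable1_diffP da <-] [/derivable1_diffP df <-].
have [/derivable1_diffP d dE] := diff_scale da df.
by apply: DeriveDef => //; exact: dE.
Qed.

Lemma is_derive_coord n (p : R -> 'rV[R]_n) (t : R) p' i :
  is_derive t 1 p p' -> is_derive t 1 (fun s => p s 0 i : R) (p' 0 i).
Proof.
move=> [dp <-]; rewrite derive_coord//.
by apply: derivableP; exact: (derivable_mxP p t 1).1.
Qed.

Lemma is_derive_lin n W (f : {linear 'rV[R]_n -> W}) (p : R -> 'rV[R]_n) (t : R) p' :
  is_derive t 1 p p' -> is_derive t 1 (f \o p) (f p').
Proof.
move=> dp.
have -> : f \o p = \sum_i (fun s => p s 0 i *: f (delta_mx 0 i)).
  apply/funext => s; rewrite /= [in LHS](row_sum_delta (p s)) linear_sum fct_sumE.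
  by apply: eq_bigr => i _; rewrite linearZ.
have -> : f p' = \sum_i (p t 0 i *: 0 + p' 0 i *: f (delta_mx 0 i)).
  rewrite [in LHS](row_sum_delta p') linear_sum.
  by apply: eq_bigr => i _; rewrite linearZ scaler0 add0r.
apply: is_derive_sum => i.
apply: is_derive_scale; first exact: is_derive_coord.
Qed.

(** Expanding the first argument in the standard basis reduces [br] to a sum of coordinates times
    linear maps. The values [x] and [y] at [t] are separate variables so that they can be given in
    simplified form. *)
Lemma is_derive_bilin n W (br : 'rV[R]_n -> 'rV[R]_n -> W)
    (p q : R -> 'rV[R]_n) (t : R) p' q' x y :
  (forall x, linear (br x)) -> (forall y, linear (br^~ y)) ->
  p t = x -> q t = y -> is_derive t 1 p p' -> is_derive t 1 q q' ->
  is_derive t 1 (fun s => br (p s) (q s)) (br p' y + br x q').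
Proof.
move=> lr ll px qy dp dq; rewrite -px -qy {x y px qy}.
rewrite [X in is_derive _ _ _ X]addrC.
pose brr x : {linear _ -> _} := HB.pack (br x) (GRing.isLinear.Build _ _ _ _ _ (lr x)).
pose brl y : {linear _ -> _} := HB.pack (br^~ y) (GRing.isLinear.Build _ _ _ _ _ (ll y)).
have E x y : br x y = \sum_i x 0 i *: brr (delta_mx 0 i) y.
  rewrite -[LHS]/(brl y x) [in LHS](row_sum_delta x) linear_sum.
  by apply: eq_bigr => i _; rewrite linearZ.
have -> : (fun s => br (p s) (q s)) =
    \sum_i (fun s => p s 0 i *: brr (delta_mx 0 i) (q s)).
  by apply/funext => s; rewrite E fct_sumE.
rewrite !E -big_split/=; apply: is_derive_sum => i.
apply: is_derive_scale; first exact: is_derive_coord.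
exact: (is_derive_lin (brr (delta_mx 0 i)) dq).
Qed.

Lemma is_derive_continuous V (p : R -> V) (t : R) p' :
  is_derive t 1 p p' -> {for t, continuous p}.
Proof. by move=> [/derivable1_diffP dp _]; exact: differentiable_continuous. Qed.

(** Product rule for the differential of [h] when base point and direction both move. Identities
    between tangent maps are differentiated along curves with it. *)
Lemma is_derive_derive_along n V W (U : set V) (L : {linear 'rV[R]_n -> V})
    (h : V -> W) (w : R -> 'rV[R]_n) (p : R -> V) (t : R) w' p' :
  open U -> ck_on 2 U h -> U (p t) ->
  is_derive t 1 w w' -> is_derive t 1 p p' ->
  is_derive t 1 (fun s => 'D_(L (w s)) h (p s))
    ('D_p' (fun z => 'D_(L (w t)) h z) (p t) + 'D_(L w') h (p t)).
Proof.
move=> oU [hd dvh] Up dw dp.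
have near_p : \forall s \near t, U (p s).
  by apply: (is_derive_continuous dp); exact: open_nbhs_nbhs.
have h_p := hd _ Up.
have near_U : \forall z \near p t, U z by exact: open_nbhs_nbhs.
have -> : 'D_p' (fun z => 'D_(L (w t)) h z) (p t) =
    \sum_i w t 0 i *: 'D_p' (fun z => 'D_(L (delta_mx 0 i)) h z) (p t).
  have dD i : derivable (w t 0 i *: (fun z => 'D_(L (delta_mx 0 i)) h z)) (p t) p'.
    by apply: derivableZ; apply: diff_derivable; apply: (dvh _).1.
  transitivity
    ('D_p' (\sum_i (w t 0 i *: (fun z => 'D_(L (delta_mx 0 i)) h z))) (p t)).
    apply: near_eq_derive; apply: filterS near_U => z /hd hz.
    by rewrite derive_lincomb// fct_sumE.
  rewrite derive_sum//; apply: eq_bigr => i _.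
  by rewrite deriveZ//; apply: diff_derivable; apply: (dvh _).1.
rewrite (derive_lincomb L w' h_p) -big_split/=.
apply: (@near_eq_is_derive _ _ _
  (\sum_i (fun s => w s 0 i *: 'D_(L (delta_mx 0 i)) h (p s)))).
  by apply: filterS near_p => s /hd hs; rewrite derive_lincomb// fct_sumE.
apply: is_derive_sum => i; apply: is_derive_scale; first exact: is_derive_coord.
apply: (is_derive_comp_curve (h := fun z => 'D_(L (delta_mx 0 i)) h z)) => //.
by apply: (dvh _).1.
Qed.

End Calculus.

(** * Local solutions of differential equations *)

Section ODE.
Variable R : realType.

Lemma is_derive_rV n (p : R -> 'rV[R]_n) (t : R) (p' : 'rV[R]_n) :
  (forall i, is_derive t 1 (fun s => p s 0 i : R) (p' 0 i)) -> is_derive t 1 p p'.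
Proof.
move=> dp.
have d : derivable p t 1.
  by apply/derivable_mxP => i j; rewrite ord1; have [] := dp j.
apply: DeriveDef => //; apply/rowP => i.
by rewrite derive_coord//; exact: (@derive_val _ _ _ _ _ _ _ (dp i)).
Qed.

Lemma coord_le n (x : 'rV[R]_n) i : `|x 0 i| <= `|x|.
Proof.
rewrite [leRHS]mx_normrE.
exact: (le_bigmax _ (fun j => `|x j.1 j.2|) (0, i)).
Qed.

Lemma norm_rV_le n (x : 'rV[R]_n) (K : R) : 0 <= K ->
  (forall i, `|x 0 i| <= K) -> `|x| <= K.
Proof.
move=> K0 xK; rewrite [leLHS]mx_normrE; apply: bigmax_le => // -[i j] _ /=.
by rewrite ord1.
Qed.

(** The scalar theorem is applied to each coordinate, which suffices because the norm is the maximum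
    of the coordinates. *)
Lemma mvt_rV n (p dp : R -> 'rV[R]_n) (a b K : R) : a <= b ->
  (forall s, a <= s <= b -> is_derive s 1 p (dp s)) ->
  (forall s, a <= s <= b -> `|dp s| <= K) ->
  `|p b - p a| <= K * (b - a).
Proof.
move=> ab pd dK.
have K0 : 0 <= K by rewrite (le_trans _ (dK a _)) ?lexx.
apply: norm_rV_le; first by rewrite mulr_ge0// subr_ge0.
move=> i; rewrite !mxE.
have [||c cab ->] := @MVT_segment R (fun s => p s 0 i) (fun s => dp s 0 i) a b ab.
- move=> s; rewrite in_itv/= => /andP[sa sb].
  by apply: is_derive_coord; apply: pd; rewrite !ltW.
- apply: derivable_within_continuous => s; rewrite in_itv/= => sab.
  by have [] := is_derive_coord i (pd s sab).
rewrite normrM [`|b - a|]ger0_norm ?subr_ge0//.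
rewrite ler_wpM2r ?subr_ge0// (le_trans (coord_le _ _))// dK//.
Qed.

Lemma mvt_rV_sym n (p dp : R -> 'rV[R]_n) (d t K : R) :
  (forall s : R, `|s| <= d -> is_derive s 1 p (dp s)) ->
  (forall s, `|s| <= d -> `|dp s| <= K) ->
  `|t| <= d -> `|p t - p 0| <= K * `|t|.
Proof.
move=> pd dK td; have [t0|t0] := leP 0 t.
  rewrite ger0_norm// -[in leRHS](subr0 t).
  by apply: mvt_rV => // s /andP[s0 st]; [apply: pd|apply: dK];
    rewrite ger0_norm// (le_trans st)// -(ger0_norm t0).
rewrite distrC ltr0_norm// -[in leRHS](add0r (- t)).
by apply: mvt_rV; rewrite ?ltW// => s /andP[st s0]; [apply: pd|apply: dK];
  rewrite ler0_norm// (le_trans _ td)// ltr0_norm// lerN2.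
Qed.

Lemma is_derive0_cst n (p : R -> 'rV[R]_n) (d t : R) :
  (forall s : R, `|s| <= d -> is_derive s 1 p 0) -> `|t| <= d -> p t = p 0.
Proof.
move=> pd td; have : `|p t - p 0| <= 0 * `|t|.
  by apply: (mvt_rV_sym pd) td => s _; rewrite normr0.
by rewrite mul0r normr_le0 subr_eq0 => /eqP.
Qed.

Lemma primitive (g : R -> R) (c : R) : continuous g ->
  exists P : R -> R, P 0 = 0 /\ forall t : R, `|t| < c -> is_derive t 1 P (g t).
Proof.
move=> cg.
(* Integrating from [- c] makes [0] an interior point; subtracting [F 0] then normalizes the
   primitive. *)
pose F x : R := (\int[lebesgue_measure]_(t in `[- c, x]) g t)%R.
exists (fun x => F x - F 0); split; first exact: subrr.
move=> t; rewrite ltr_norml => /andP[ct tc].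
have [|||dF F't] := @continuous_FTC1_closed R g (- c) t c tc.
- apply: continuous_compact_integrable; first exact: segment_compact.
  exact: continuous_subspaceT.
- exact: ct.
- exact: cg.
have dFt : is_derive t 1 F (g t) by apply: DeriveDef => //; rewrite -derive1E.
by rewrite -(subr0 (g t)); exact: is_deriveB.
Qed.

Lemma primitive_rV n (g : R -> 'rV[R]_n) (c : R) : continuous g ->
  exists P : R -> 'rV[R]_n,
    P 0 = 0 /\ forall t : R, `|t| < c -> is_derive t 1 P (g t).
Proof.
move=> cg.
have /choice[P PP] i : exists P : R -> R,
    P 0 = 0 /\ forall t : R, `|t| < c -> is_derive t 1 P (g t 0 i).
  apply: primitive => t.
  by apply: (@continuous_comp _ _ _ g (fun M : 'rV[R]_n => M 0 i));
    [exact: cg|exact: coord_continuous].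
exists (fun t => \row_i P i t); split.
  by apply/rowP => i; rewrite !mxE (PP i).1.
move=> t tc; apply: is_derive_rV => i.
by under eq_fun do rewrite mxE; exact: (PP i).2.
Qed.

Lemma near_dist_lt (V : normedModType R) (x : V) (d : R) : 0 < d ->
  \forall y \near x, `|x - y| < d.
Proof. by move=> d0; apply/nbhs_ballP; exists d => // y; rewrite -ball_normE. Qed.

Lemma near_distC_lt (V : normedModType R) (x : V) (d : R) : 0 < d ->
  \forall y \near x, `|y - x| < d.
Proof. by move=> /(near_dist_lt x); apply: filterS => y; rewrite distrC. Qed.

Lemma lipschitz_continuous (V W : normedModType R) (F : V -> W) (L : R) :
  (forall u v, `|F u - F v| <= L * `|u - v|) -> continuous F.
Proof.
move=> FL x; apply/cvgrPdist_lt => e e0; near=> y.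
have L1 : 0 < `|L| + 1 by rewrite ltr_wpDl.
apply: (le_lt_trans (FL _ _)).
apply: (@le_lt_trans _ _ ((`|L| + 1) * `|x - y|)).
  by rewrite ler_wpM2r// (le_trans (ler_norm L))// lerDl.
rewrite -ltr_pdivlMl//; near: y.
by apply: near_dist_lt; rewrite mulr_gt0// invr_gt0.
Unshelve. all: by end_near. Qed.

(** For [0 <= d], the nearest-point retraction onto [[-d, d]]. It is applied to time in [picard] and
    to the coordinates of space in [ode_local]. *)
Definition clamp (d t : R) : R := Num.max (- d) (Num.min d t).

Lemma clamp_norm d t : 0 <= d -> `|clamp d t| <= d.
Proof.
move=> d0; rewrite ler_norml /clamp le_max lexx/= ge_max ge_min lexx andbT.
by rewrite (le_trans _ d0)// oppr_le0.
Qed.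

Lemma clamp_id d t : `|t| <= d -> clamp d t = t.
Proof.
by rewrite ler_norml => /andP[dt td]; rewrite /clamp min_r// max_r.
Qed.

Lemma clamp_dist d s t : `|clamp d s - clamp d t| <= `|s - t|.
Proof.
rewrite /clamp /Num.max /Num.min ler_norml; case: (ler0P (s - t)) => ?;
case: (ltP d s) => ?; case: (ltP d t) => ?; repeat (case: ltP => ?);
by apply/andP; split; lra.
Qed.

Lemma clamp_continuous d : continuous (clamp d).
Proof.
by apply: (@lipschitz_continuous R R _ 1) => u v; rewrite mul1r; exact: clamp_dist.
Qed.

Lemma geometric_small (K e : R) : 0 < e -> exists k, K / 2 ^+ k < e.
Proof.
move=> e0; have := @cvg_geometric R K 2^-1; rewrite ger0_norm// invf_lt1// ltr1n.
move=> /(_ isT)/cvgr0Pnorm_lt/(_ e e0)[k _ /(_ k)/=].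
rewrite leqnn exprVn => /(_ isT) ke; exists k.
by rewrite (le_lt_trans _ ke)// ler_norm.
Qed.

Lemma geometric_cauchy n (u : nat -> 'rV[R]_n) (K : R) :
  (forall k, `|u k.+1 - u k| <= K / 2 ^+ k) ->
  exists l, forall k, `|l - u k| <= 2 * K / 2 ^+ k.
Proof.
move=> uK.
have K0 : 0 <= K by have := uK 0%N; rewrite expr0 divr1; exact: le_trans.
(* Keeping the subtracted tail makes the bound telescope, so that the induction on [j] closes. *)
have uD k j : `|u (k + j)%N - u k| <= 2 * K / 2 ^+ k - 2 * K / 2 ^+ (k + j).
  elim: j => [|j IH]; first by rewrite addn0 !subrr normr0.
  rewrite addnS -(subrKA (u (k + j)%N)) (le_trans (ler_normD _ _))//.
  apply: (le_trans (lerD (uK _) IH)); rewrite exprSr invfM.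
  by set a := 2 * K / 2 ^+ k; set b := _^-1; lra.
have pos j : 0 <= 2 * K / 2 ^+ j by rewrite !mulr_ge0// invr_ge0 exprn_ge0.
have uM k m : (k <= m)%N -> `|u m - u k| <= 2 * K / 2 ^+ k.
  move=> km; rewrite -(subnKC km) (le_trans (uD _ _))// gerBl; exact: pos.
have cu : cauchy (u @ \oo).
  apply: cauchy_exP => e e0; have [k ke] := geometric_small (2 * K) e0.
  exists (u k); exists k => // m km.
  by rewrite -ball_normE /= distrC (le_lt_trans (uM _ _ km)).
have /cauchy_cvg cvu := cu.
exists (lim (u @ \oo)) => k; apply/ler_addgt0Pr => e e0.
have [m _ /(_ (maxn m k) (leq_maxl _ _)) /= le] := (@cvgr_dist_lt _ _ _ _ _ _ _ cvu _ e0).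
rewrite -(subrKA (u (maxn m k))) (le_trans (ler_normD _ _))// addrC.
by apply: lerD; [exact/uM/leq_maxr|exact: ltW].
Qed.

Lemma uniform_limit_continuous_rV n (y : nat -> R -> 'rV[R]_n) z (K : R) :
  (forall k, continuous (y k)) ->
  (forall k t, `|z t - y k t| <= K / 2 ^+ k) -> continuous z.
Proof.
move=> yc zy t.
apply/(@cvgrPdist_lt R 'rV[R]_n) => e e0.
have e30 : 0 < e / 3 by rewrite divr_gt0.
have [k ke] := geometric_small K e30.
have /(@cvgrPdist_lt R 'rV[R]_n)/(_ _ e30) yk := yc k t.
near=> s.
have yks : `|y k t - y k s| < e / 3 by near: s.
rewrite -(subrKA (y k t)) -[X in _ + X](subrKA (y k s)).
have A := zy k t; have := zy k s; rewrite distrC => B.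
apply: (le_lt_trans (ler_normD _ _)).
rewrite [e](_ : _ = e / 3 + (e / 3 + e / 3)); last by lra.
apply: ltrD; first exact: le_lt_trans ke.
apply: (le_lt_trans (ler_normD _ _)).
by apply: ltrD => //; exact: le_lt_trans ke.
Unshelve. all: by end_near. Qed.

Lemma picard n (F : 'rV[R]_n -> 'rV[R]_n) (L : R) (x0 : 'rV[R]_n) :
  (forall u v, `|F u - F v| <= L * `|u - v|) ->
  exists (d : R) (y : R -> 'rV[R]_n), [/\ 0 < d, y 0 = x0 &
    forall t : R, `|t| < d -> is_derive t 1 y (F (y t))].
Proof.
move=> FL.
(* Chosen so that [L] times the length of the time interval is at most one half; the [+ 1] covers
   [L = 0]. *)
pose d : R := (2 * (`|L| + 1))^-1.
have L1 : 0 < `|L| + 1 by rewrite ltr_wpDl.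
have d0 : 0 < d by rewrite invr_gt0 mulr_gt0.
have Ld : `|L| * d <= 2^-1.
  by rewrite /d invfM mulrCA ler_piMr// ler_pdivrMr// mul1r lerDl.
have Fc : continuous F := lipschitz_continuous FL.
(* The implication makes the relation total, so that choice yields an operator on all functions; a
   discontinuous [g] gets the value [0]. The radius [2 * d] leaves room around the closed interval
   [[-d, d]]. *)
pose prim_spec (g P : R -> 'rV[R]_n) := continuous g ->
  P 0 = 0 /\ forall t : R, `|t| < 2 * d -> is_derive t 1 P (g t).
have /choice[prim primP] g : exists P, prim_spec g P.
  have [cg|ncg] := pselect (continuous g); last by exists (cst 0).
  by have [P PP] := primitive_rV (2 * d) cg; exists P.
(* Clamping the time makes [T] a contraction for the sup norm on the whole line. *)
pose T (z : R -> 'rV[R]_n) : R -> 'rV[R]_n :=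
  fun t => x0 + prim (F \o z) (clamp d t).
have cF (z : R -> 'rV[R]_n) : continuous z -> continuous (F \o z).
  by move=> cz t; exact: (@continuous_comp _ _ _ z F t (cz t) (Fc (z t))).
have lt2d s : `|s| <= d -> `|s| < 2 * d.
  by move=> sd; apply: (le_lt_trans sd); rewrite ltr_pMl// ltr1n.
have Tc z : continuous z -> continuous (T z).
  move=> cz t; apply: (@continuousD R 'rV[R]_n R (cst x0)); first exact: cvg_cst.
  apply: (@continuous_comp _ _ _ (clamp d) (prim (F \o z))).
    exact: clamp_continuous.
  have [_ /(_ (clamp d t)) dP] := primP _ (cF _ cz).
  by apply: is_derive_continuous (dP _); rewrite lt2d// clamp_norm// ltW.
have TL z w K : continuous z -> continuous w ->
    (forall t, `|z t - w t| <= K) -> forall t, `|T z t - T w t| <= K / 2.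
  move=> cz cw zwK t.
  have [Pz dPz] := primP _ (cF _ cz); have [Pw dPw] := primP _ (cF _ cw).
  have K0 : 0 <= K by exact: le_trans (zwK 0).
  have td : `|clamp d t| <= d by rewrite clamp_norm// ltW.
  pose p s := prim (F \o z) s - prim (F \o w) s.
  have p0 : p 0 = 0 by rewrite /p Pz Pw subrr.
  have -> : T z t - T w t = p (clamp d t) - p 0.
    by rewrite p0 subr0 /T /p opprD addrACA subrr add0r.
  have := @mvt_rV_sym n p (fun s => F (z s) - F (w s)) d (clamp d t) (`|L| * K).
  move=> /(_ _ _ td) H; apply: le_trans (H _ _) _.
  - by move=> s sd; apply: is_deriveB; [apply: dPz|apply: dPw]; exact: lt2d.
  - move=> s _; rewrite (le_trans (FL _ _))//.
    rewrite (le_trans (ler_wpM2r _ (ler_norm L)))// ler_wpM2l//.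
  - rewrite mulrAC [leRHS]mulrC ler_wpM2r//.
    by apply: le_trans Ld; rewrite ler_wpM2l.
pose y k := iter k T (cst x0).
have yc k : continuous (y k).
  by elim: k => [|k IH]; [move=> t; exact: cvg_cst|exact: Tc].
pose K0 := `|F x0| * d.
have y1 t : `|y 1 t - y 0 t| <= K0.
  have cg : continuous (F \o (cst x0 : R -> 'rV[R]_n)) by apply: cF => s; exact: cvg_cst.
  have [P0 dP] := primP _ cg.
  have td : `|clamp d t| <= d by rewrite clamp_norm// ltW.
  rewrite /y /= /T addrAC subrr add0r -[X in `|X|]subr0 -P0.
  apply: le_trans (mvt_rV_sym (K := `|F x0|) _ _ td) _.
  - by move=> s sd; apply: dP; exact: lt2d.
  - by [].
  - by rewrite ler_wpM2l.
have yK k t : `|y k.+1 t - y k t| <= K0 / 2 ^+ k.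
  elim: k t => [|k IH] t; first by rewrite expr0 divr1.
  by rewrite exprSr invfM mulrA; exact: (TL _ _ _ (yc k.+1) (yc k) IH t).
have /choice[z zP] t : exists l, forall k, `|l - y k t| <= 2 * K0 / 2 ^+ k.
  by apply: geometric_cauchy => k; exact: yK.
have zc : continuous z.
  exact: (uniform_limit_continuous_rV yc (fun k t => zP t k)).
(* For every [k], both [T z] and [z] are within half of [2 * K0 / 2 ^+ k] of the iterate
   [y k.+1]. *)
have Tz t : T z t = z t.
  apply/eqP; rewrite -subr_eq0 -normr_le0; apply/ler_addgt0Pr => e e0; rewrite add0r.
  have [k ke] := geometric_small (2 * K0) e0.
  rewrite -(subrKA (y k.+1 t)) (le_trans (ler_normD _ _))//.
  have A := TL z (y k) _ zc (yc k) (fun t => zP t k) t.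
  have := zP t k.+1; rewrite distrC => B.
  have E : 2 * K0 / 2 ^+ k.+1 = 2 * K0 / 2 ^+ k / 2 by rewrite exprSr invfM mulrA.
  rewrite E in B; apply: (le_trans (lerD A B)).
  by rewrite -splitr ltW.
have zE t : z t = x0 + prim (F \o z) (clamp d t) by rewrite -[LHS]Tz.
have [P0 dP] := primP _ (cF _ zc).
exists d, z; split=> //.
  by rewrite zE clamp_id ?normr0 ?ltW// P0 addr0.
move=> t td.
(* Inside the open interval the clamping is the identity, so [z] is locally a primitive of
   [F \o z]. *)
apply: (@near_eq_is_derive _ _ _ (fun s => x0 + prim (F \o z) s)).
  near=> s; rewrite zE clamp_id// ltW//.
  by near: s; apply: (@cvgr_norm_lt _ R _ _ _ id t) => //; exact: cvg_id.
rewrite -[F (z t)]add0r.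
have dPt : is_derive t 1 (prim (F \o z)) (F (z t)) by apply: dP; rewrite lt2d// ltW.
exact: (@is_deriveD _ _ _ (cst x0)).
Unshelve. all: by end_near. Qed.

(** By continuity each partial derivative exceeds its norm at [x0] by at most 1 on a small ball; the
    mean value inequality on segments of that ball gives the sum of these bounds as Lipschitz
    constant. *)
Lemma c1_locally_lipschitz n m (U : set 'rV[R]_n) (f : 'rV[R]_n -> 'rV[R]_m)
    (x0 : 'rV[R]_n) :
  open U -> ck_on 1 U f -> U x0 ->
  exists r L : R, [/\ 0 < r, forall u, `|u - x0| <= r -> U u &
    forall u v, `|u - x0| <= r -> `|v - x0| <= r -> `|f u - f v| <= L * `|u - v|].
Proof.
move=> oU [fd dvf] Ux0.
pose D i z := 'D_(delta_mx 0 i) f z.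
have [r [r0 rP]] : exists r : R, 0 < r /\ forall u, `|u - x0| <= r ->
    U u /\ forall i, `|D i u| <= `|D i x0| + 1.
  have : \forall u \near x0, U u /\ forall i, `|D i u| <= `|D i x0| + 1.
    apply: filterI; first exact: open_nbhs_nbhs.
    have H i : \forall u \near x0, `|D i u| <= `|D i x0| + 1.
      have Dc : {for x0, continuous (D i)} by exact: dvf.
      have := @cvgr_norm_le _ _ _ _ _ _ _ Dc (`|D i x0| + 1).
      by apply; rewrite ltrDl.
    exact: filter_forall H.
  move=> /nbhs_ballP[r /= r0 rP]; exists (r / 2); split; first by rewrite divr_gt0.
  move=> u ur; apply: rP; rewrite -ball_normE /= distrC (le_lt_trans ur)//.
  by rewrite ltr_pdivrMr// ltr_pMr// ltr1n.
pose L := \sum_i (`|D i x0| + 1).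
exists r, L; split=> // [u /rP[]//|u v ur vr].
have seg s : 0 <= s <= 1 -> `|v + s *: (u - v) - x0| <= r.
  move=> /andP[s0 s1].
  have -> : v + s *: (u - v) - x0 = (1 - s) *: (v - x0) + s *: (u - x0).
    by apply/rowP => i; rewrite !mxE; ring.
  apply: (le_trans (ler_normD _ _)); rewrite !normrZ.
  rewrite (ger0_norm s0) (@ger0_norm _ (1 - s)) ?subr_ge0//.
  have A : (1 - s) * `|v - x0| <= (1 - s) * r by rewrite ler_wpM2l// subr_ge0.
  have B : s * `|u - x0| <= s * r by rewrite ler_wpM2l.
  apply: (le_trans (lerD A B)); lra.
have := @mvt_rV m (fun s => f (v + s *: (u - v)))
  (fun s => 'D_(u - v) f (v + s *: (u - v))) 0 1 (L * `|u - v|) ler01.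
rewrite scale1r scale0r addr0 subr0 mulr1 addrCA subrr addr0; apply.
- move=> s sI; apply: (is_derive_comp_curve (h := f)
    (p := fun r : R => v + r *: (u - v))); last exact: is_derive_line.
  by apply: fd; apply: (rP _ (seg _ sI)).1.
- move=> s sI; have [Us Ds] := rP _ (seg _ sI).
  rewrite (derive_lincomb idfun) /=; last exact: fd.
  rewrite (le_trans (ler_norm_sum _ _ _))// /L mulr_suml.
  apply: ler_sum => i _; rewrite normrZ mulrC.
  by apply: ler_pM => //; [exact: Ds|exact: coord_le].
Qed.

Lemma continuous_near0 (V : normedModType R) (y : R -> V) (r : R) :
  {for 0, continuous y} -> 0 < r ->
  exists e : R, 0 < e /\ forall s, `|s| < e -> `|y s - y 0| < r.
Proof.
move=> yc r0.
have /nbhs_ballP[e /= e0 eP] : \forall t \near (0 : R), `|y t - y 0| < r.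
  by apply: (yc (fun z => `|z - y 0| < r)); exact: near_distC_lt.
by exists e; split=> // s se; apply: eP; rewrite -ball_normE /= sub0r normrN.
Qed.

Lemma ode_local n (U : set 'rV[R]_n) (F : 'rV[R]_n -> 'rV[R]_n) (x0 : 'rV[R]_n) :
  open U -> ck_on 1 U F -> U x0 ->
  exists (d : R) (y : R -> 'rV[R]_n), [/\ 0 < d, y 0 = x0 &
    forall t : R, `|t| < d -> U (y t) /\ is_derive t 1 y (F (y t))].
Proof.
move=> oU F1 Ux0; have [r [L [r0 rU FL]]] := c1_locally_lipschitz oU F1 Ux0.
(* Precomposing [F] with the clamping [c] onto a box around [x0] makes it globally
   Lipschitz without changing it near [x0]. *)
pose c (u : 'rV[R]_n) : 'rV[R]_n := \row_i (x0 0 i + clamp r (u 0 i - x0 0 i)).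
have cr u : `|c u - x0| <= r.
  apply: norm_rV_le; first exact: ltW.
  by move=> i; rewrite !mxE addrAC subrr add0r clamp_norm// ltW.
have cL u v : `|c u - c v| <= `|u - v|.
  apply: norm_rV_le => // i; rewrite !mxE opprD addrACA subrr add0r.
  apply: (le_trans (clamp_dist _ _ _)).
  rewrite opprB addrA subrK (le_trans _ (coord_le _ i))// !mxE//.
have c_id u : `|u - x0| <= r -> c u = u.
  move=> ur; apply/rowP => i; rewrite !mxE clamp_id; first by rewrite addrCA subrr addr0.
  by rewrite (le_trans _ ur)// (le_trans _ (coord_le _ i))// !mxE//.
have [|d [y [d0 y0 dy]]] := @picard n (F \o c) `|L| x0.
  move=> u v; apply: (le_trans (FL _ _ (cr u) (cr v))).
  apply: (@le_trans _ _ (`|L| * `|c u - c v|)).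
    by rewrite ler_wpM2r// ler_norm.
  by rewrite ler_wpM2l.
have yc : {for 0, continuous y}.
  by apply: is_derive_continuous (dy 0 _); rewrite normr0.
have [e [e0 eP]] := continuous_near0 yc r0.
(* Before time [e] the solution stays within [r] of [x0], where [c] is the identity, so that it
   solves the original equation. *)
exists (Num.min d e), y; split=> //; first by rewrite lt_min d0.
move=> t; rewrite lt_min => /andP[td te].
have yt : `|y t - x0| <= r.
  by rewrite -y0; apply/ltW/eP.
split; first exact: rU.
by have := dy t td; rewrite /= c_id.
Qed.

End ODE.

(** * Smooth maps *)

Section SmoothMaps.
Variable R : realType.
Implicit Types E F G : normedModType R.

Lemma open_setX (M N : topologicalType) (A : set M) (B : set N) :
  open A -> open B -> open (A `*` B).
Proof.
move=> oA oB; have -> : A `*` B = fst @^-1` A `&` snd @^-1` B by [].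
have /continuousP c1 : continuous (@fst M N) by move=> x; exact: cvg_fst.
have /continuousP c2 : continuous (@snd M N) by move=> x; exact: cvg_snd.
by apply: openI; [exact: c1|exact: c2].
Qed.

Lemma continuous_prod_map (M N P Q : topologicalType) (f : M -> P) (g : N -> Q)
    (p : M * N) :
  {for p.1, continuous f} -> {for p.2, continuous g} ->
  {for p, continuous (fun q => (f q.1, g q.2))}.
Proof.
case: p => a b cf cg.
have c1 : fst @ (a, b) --> a by exact: cvg_fst.
have c2 : snd @ (a, b) --> b by exact: cvg_snd.
have c1f : f q.1 @[q --> (a, b)] --> f a by exact: (cvg_comp _ _ c1 cf).
have c2g : g q.2 @[q --> (a, b)] --> g b by exact: (cvg_comp _ _ c2 cg).
exact: cvg_pair c1f c2g.
Qed.

Lemma is_chart_prod (M N : topologicalType) E F (A : M -> chart M E)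
    (B : N -> chart N F) (p : M * N) :
  is_chart (A p.1) -> is_chart (B p.2) -> is_chart (prod_atlas A B p).
Proof.
move=> [oA iA AK cA ciA] [oB iB BK cB ciB].
have imgE : cimg (prod_atlas A B p) = cimg (A p.1) `*` cimg (B p.2).
  apply/seteqP; split=> [_ [[a b] /= [Aa Bb] <-]|[_ _] /= [[a Aa <-] [b Bb <-]]].
    by split; [exists a|exists b].
  by exists (a, b).
split.
- exact: open_setX.
- by rewrite imgE; exact: open_setX.
- by move=> [a b]; rewrite inE /= => -[Aa Bb]; rewrite AK ?inE// BK ?inE.
- move=> [a b]; rewrite inE /= => -[Aa Bb].
  by apply: continuous_prod_map; [apply: cA|apply: cB]; rewrite inE.
- rewrite imgE => -[a b]; rewrite inE /= => -[Aa Bb].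
  by apply: continuous_prod_map; [apply: ciA|apply: ciB]; rewrite inE.
Qed.

(** Around [p], the charts at [f p] and [g p] are inserted; on the open set of points that [f] and
    [g] send into them, the chart expression is a composite to which [ck_on_comp2] applies. *)
Lemma smooth_map_comp2 (M N P Q : topologicalType) E G n m
    (A : M -> chart M E) (B : N -> chart N 'rV[R]_n) (C : P -> chart P 'rV[R]_m)
    (D : Q -> chart Q G) (f : M -> N) (g : M -> P) (h : N * P -> Q) :
  (forall x, is_chart (A x)) -> is_smooth_atlas B -> is_smooth_atlas C ->
  (forall x, is_chart (D x)) ->
  smooth_map A B f -> smooth_map A C g -> smooth_map (prod_atlas B C) D h ->
  smooth_map A D (fun x => h (f x, g x)).
Proof.
move=> Ac [Bc Bx _] [Cc Cx _] Dc [fc fs] [gc gs] [hc hs].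
have fgc : continuous (fun x => (f x, g x)).
  by move=> x; exact: cvg_pair (fc x) (gc x).
split=> [x|x z].
  exact: (@continuous_comp _ _ _ (fun x => (f x, g x)) h x (fgc x) (hc _)).
move=> k; apply: ck_on_local => _ [p [Ap Dp] <-].
have [_ _ AK _ _] := Ac x.
have [oB _ BK _ _] := Bc (f p); have [oC _ CK _ _] := Cc (g p).
have [oD _ _ _ _] := Dc z.
pose S := (fun x => (f x, g x)) @^-1`
  ((cdom (B (f p)) `*` cdom (C (g p))) `&` h @^-1` cdom (D z)).
exists (cfun (A x) @` (cdom (A x) `&` S)).
  by exists p.
have oS : open (cfun (A x) @` (cdom (A x) `&` S)).
  apply: open_cfun_image => //; move/continuousP : fgc; apply.
  by apply: openI; [exact: open_setX|move/continuousP : hc; apply].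
apply: (ck_on_eq oS _ (ck_on_comp2 oS _ (ck_on_sub _ (fs x (f p) k))
  (ck_on_sub _ (gs x (g p) k)) (hs (f p, g p) z k))).
- move=> _ [q [Aq [[/= Bq Cq] Dq]] <-] /=.
  by rewrite AK ?inE//= BK ?inE// CK ?inE.
- move=> _ [q [Aq [[/= Bq Cq] Dq]] <-] /=; exists (f q, g q) => //.
  by rewrite /= AK ?inE.
- by move=> _ [q [Aq [[/= Bq Cq] Dq]] <-]; exists q.
- by move=> _ [q [Aq [[/= Bq Cq] Dq]] <-]; exists q.
Qed.

Lemma smooth_map_cst (M N : topologicalType) E F (A : M -> chart M E)
  (B : N -> chart N F) (b : N) : smooth_map A B (fun=> b).
Proof. by split=> [x|x y k]; [exact: cvg_cst|exact: ck_on_cst]. Qed.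

Lemma derive_linear (V W : normedModType R) (f : {linear V -> W}) x v :
  continuous f -> differentiable f x /\ 'D_v f x = f v.
Proof.
by move=> fc; have df := linear_differentiable x fc; rewrite deriveE// diff_lin.
Qed.

(** In charts, the projection is a transition map of [A] after the linear projection. *)
Lemma smooth_map_fst (M N : topologicalType) E F (A : M -> chart M E)
    (B : N -> chart N F) :
  is_smooth_atlas A -> (forall y, is_chart (B y)) ->
  smooth_map (prod_atlas A B) A fst.
Proof.
move=> [Ac Ax As] Bc; split=> [x|[x1 x2] y k]; first exact: cvg_fst.
have [oA _ _ _ _] := Ac y; have [_ _ AK _ _] := Ac x1.
apply: (@ck_on_affine _ _ _ _ k _ _ fst fst _ _ _ _ (As x1 y k)).
- apply: open_cfun_image; first exact: is_chart_prod.
  have /continuousP : continuous (@fst M N) by move=> z; exact: cvg_fst.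
  exact.
- by move=> _ [[a b] [[/= Aa Bb] /= Ay] <-]; exists a.
- move=> p v; apply: (@derive_linear _ _ fst) => z; exact: cvg_fst.
Qed.

Lemma smooth_map_snd (M N : topologicalType) E F (A : M -> chart M E)
    (B : N -> chart N F) :
  (forall y, is_chart (A y)) -> is_smooth_atlas B ->
  smooth_map (prod_atlas A B) B snd.
Proof.
move=> Ac [Bc Bx Bs]; split=> [x|[x1 x2] y k]; first exact: cvg_snd.
have [oB _ _ _ _] := Bc y; have [_ _ BK _ _] := Bc x2.
apply: (@ck_on_affine _ _ _ _ k _ _ snd snd _ _ _ _ (Bs x2 y k)).
- apply: open_cfun_image; first exact: is_chart_prod.
  have /continuousP : continuous (@snd M N) by move=> z; exact: cvg_snd.
  exact.
- by move=> _ [[a b] [[/= Aa Bb] /= By] <-]; exists b.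
- move=> p v; apply: (@derive_linear _ _ snd) => z; exact: cvg_snd.
Qed.

Lemma is_smooth_atlas_prod (M N : topologicalType) E F (A : M -> chart M E)
    (B : N -> chart N F) :
  is_smooth_atlas A -> is_smooth_atlas B -> is_smooth_atlas (prod_atlas A B).
Proof.
move=> sA sB; have [Ac Ax _] := sA; have [Bc Bx _] := sB.
split=> [x|x|x y k]; first exact: is_chart_prod.
  by split; [exact: Ax|exact: Bx].
have [oA _ _ _ _] := Ac y.1; have [oB _ _ _ _] := Bc y.2.
apply: (ck_on_pair (f := cfun (A y.1) \o fst \o cinv (prod_atlas A B x))
  (g := cfun (B y.2) \o snd \o cinv (prod_atlas A B x))).
- apply: open_cfun_image; first exact: is_chart_prod.
  exact: open_setX.
- apply: (ck_on_sub _ ((smooth_map_fst sA Bc).2 x y.1 k)).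
  by move=> _ [p [xp [yp1 yp2]] <-]; exists p.
- apply: (ck_on_sub _ ((smooth_map_snd Ac sB).2 x y.2 k)).
  by move=> _ [p [xp [yp1 yp2]] <-]; exists p.
Qed.

Lemma derive_affine (a b t v : R) :
  differentiable (fun t : R => b + t * a) t /\ 'D_v (fun t : R => b + t * a) t = v * a.
Proof.
have H : is_diff t ((cst b : R -> R) + *:%R^~ a) (0 + *:%R^~ a) by apply: is_diffD.
have dL : differentiable ((cst b : R -> R) + *:%R^~ a) t by exact: ex_diff.
by split=> //; rewrite deriveE// diff_val /= add0r.
Qed.

Lemma smooth_curve_affine (N : topologicalType) F (B : N -> chart N F)
    (c : R -> N) (a b : R) :
  (forall y, is_chart (B y)) ->
  smooth_map (@line_atlas R) B c ->
  smooth_map (@line_atlas R) B (fun t => c (b + t * a)).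
Proof.
move=> Bc [cc cs].
have Lc : continuous (fun t : R => b + t * a).
  by move=> t; apply: cvgD; [exact: cvg_cst|apply: cvgMr_tmp; exact: cvg_id].
have cLc : continuous (c \o (fun t : R => b + t * a)).
  by move=> t; exact: (@continuous_comp _ _ _ _ c t (Lc t) (cc _)).
split=> [//|x y k].
have [oB _ _ _ _] := Bc y.
apply: (@ck_on_affine _ _ _ _ k _ _ (fun t : R => b + t * a) (fun t => t * a)
  _ _ _ _ (cs x y k)).
- rewrite image_id setTI.
  by move/continuousP : cLc; exact.
- by move=> _ [t [_ ct] <-]; exists (b + t * a).
- exact: derive_affine.
Qed.

Lemma is_derive_pair (V W : normedModType R) (f : R -> V) (g : R -> W) (t : R) f' g' :
  is_derive t 1 f f' -> is_derive t 1 g g' ->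
  is_derive t 1 (fun s => (f s, g s)) (f', g').
Proof.
move=> [/derivable1_diffP df <-] [/derivable1_diffP dg <-].
apply: DeriveDef; last exact: derive_pair.
by apply/derivable1_diffP; exact: differentiable_pair.
Qed.

(** Continuity keeps [c] inside the chart at [x] for times near [t], where [cinv] after [cfun] is
    the identity; the ordinary chain rule then applies. *)
Lemma smooth_map_curve (M N : topologicalType) E F (A : M -> chart M E)
    (B : N -> chart N F) (f : M -> N) (c : R -> M) (t : R) x y v :
  is_chart (A x) -> smooth_map A B f ->
  {for t, continuous c} -> cdom (A x) (c t) -> cdom (B y) (f (c t)) ->
  is_derive t 1 (cfun (A x) \o c) v ->
  is_derive t 1 (cfun (B y) \o f \o c)
    ('D_v (cfun (B y) \o f \o cinv (A x)) (cfun (A x) (c t))).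
Proof.
move=> [oA _ AK _ _] [fc fs] cc Act Bft dc.
have near_A : \forall s \near t, cdom (A x) (c s).
  by apply: (cc (cdom (A x))); exact: open_nbhs_nbhs.
apply: (@near_eq_is_derive _ _ _
  ((cfun (B y) \o f \o cinv (A x)) \o (cfun (A x) \o c))).
  by apply: filterS near_A => s As /=; rewrite AK ?inE.
apply: is_derive_comp_curve => //=.
by have [df _] := fs x y 1%N; apply: df; exists (c t).
Qed.

End SmoothMaps.

Local Notation phi G := (cfun (@mfd_chart _ G 1%g)).
Local Notation psi G := (cinv (@mfd_chart _ G 1%g)).
Local Notation "M .-atlas" := (@mfd_chart _ M) (at level 2, format "M .-atlas").

(** * Velocities of curves in a Lie group *)

Section PartialDerivatives.
Variable R : realType.
Implicit Types V W : normedModType R.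

Lemma derive_pairl V1 V2 W (h : V1 * V2 -> W) p q (v : V1) :
  'D_(v, 0 : V2) h (p, q) = 'D_v (fun u => h (u, q)) p.
Proof.
rewrite /derive.
have -> // : (fun t : R => t^-1 *: ((h \o shift (p, q)) (t *: (v, 0 : V2)) - h (p, q)))
  = (fun t : R => t^-1 *: (((fun u => h (u, q)) \o shift p) (t *: v) - h (p, q))).
apply/funext => t; congr (_ *: (h _ - _)).
by apply: injective_projections; rewrite /= ?scaler0 ?add0r.
Qed.

Lemma derive_pairr V1 V2 W (h : V1 * V2 -> W) p q (v : V2) :
  'D_(0 : V1, v) h (p, q) = 'D_v (fun u => h (p, u)) q.
Proof.
rewrite /derive.
have -> // : (fun t : R => t^-1 *: ((h \o shift (p, q)) (t *: (0 : V1, v)) - h (p, q)))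
  = (fun t : R => t^-1 *: (((fun u => h (p, u)) \o shift q) (t *: v) - h (p, q))).
apply/funext => t; congr (_ *: (h _ - _)).
by apply: injective_projections; rewrite /= ?scaler0 ?add0r.
Qed.

Lemma derive_pairD V1 V2 W (h : V1 * V2 -> W) p q (v1 : V1) (v2 : V2) :
  differentiable h (p, q) ->
  'D_(v1, v2) h (p, q) =
  'D_v1 (fun u => h (u, q)) p + 'D_v2 (fun u => h (p, u)) q.
Proof.
move=> dh; rewrite -derive_pairl -derive_pairr !deriveE// -linearD.
by congr ('d h _ _); congr pair; rewrite /= ?addr0 ?add0r.
Qed.

Lemma derive_id_near V (f : V -> V) p v :
  (\forall u \near p, f u = u) -> 'D_v f p = v.
Proof. by move=> fid; rewrite (near_eq_derive v fid) derive_id. Qed.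

Lemma is_derive_unique V (f : R -> V) (t : R) v w :
  is_derive t 1 f v -> is_derive t 1 f w -> v = w.
Proof. by move=> [_ <-] [_ <-]. Qed.

Lemma is_derive_translate V (f : R -> V) (s t : R) v :
  is_derive s 1 f v -> is_derive t 1 (fun z => f (z + (s - t))) v.
Proof.
move=> df.
have dL : is_derive t 1 (fun z : R => (s - t) + z *: 1) (1 : R) by exact: is_derive_line.
have E : (s - t) + t *: 1 = s by rewrite [_ *: _]mulr1 subrK.
have -> : (fun z => f (z + (s - t))) = f \o (fun z : R => (s - t) + z *: 1).
  by apply/funext => z; rewrite /= [_ *: _]mulr1 addrC.
have -> : v = 'D_1 f ((s - t) + t *: 1) by rewrite E; case: df.
apply: is_derive_comp_curve => //; rewrite E; apply/derivable1_diffP.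
by case: df.
Qed.

End PartialDerivatives.

(* Continuity keeps [c] inside the chart around [0]; without it, [phi G \o c] could
   be differentiable because of the meaningless values of [phi G]. *)
Definition has_velocity (R : realType) (G : lieGroupType R) (c : R -> G)
    (x : 'rV[R]_(mfd_dim G)) :=
  [/\ c 0 = 1%g, {for 0, continuous c} & is_derive (0 : R) 1 (phi G \o c) x].

Section LieGroupCurves.
Variables (R : realType) (G : lieGroupType R).
Implicit Types (c q : R -> G) (x y : 'rV[R]_(mfd_dim G)).

Lemma chartP (M : smoothManifoldType R) (x : M) : is_chart (mfd_chart x).
Proof. by have [] := @mfd_chartP R M. Qed.

Lemma chart_dom (M : smoothManifoldType R) (x : M) : cdom (mfd_chart x) x.
Proof. by have [] := @mfd_chartP R M. Qed.

Lemma chartK (M : smoothManifoldType R) (x p : M) :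
  cdom (mfd_chart x) p -> cinv (mfd_chart x) (cfun (mfd_chart x) p) = p.
Proof. by have [_ _ AK _ _] := chartP x; move=> xp; rewrite AK ?inE. Qed.

Lemma chart_near (M : smoothManifoldType R) (x p : M) :
  cdom (mfd_chart x) p -> \forall q \near p, cdom (mfd_chart x) q.
Proof. by have [oA _ _ _ _] := chartP x => xp; exact: open_nbhs_nbhs. Qed.

Lemma prod_chartP (p : G * G) : is_chart (prod_atlas G.-atlas G.-atlas p).
Proof. by apply: is_chart_prod; exact: chartP. Qed.

Section SmoothOperations.
Variables (M : topologicalType) (E : normedModType R) (B : M -> chart M E).
Hypothesis Bs : is_smooth_atlas B.

Lemma smooth_map_mulg (f g : M -> G) :
  smooth_map B G.-atlas f -> smooth_map B G.-atlas g ->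
  smooth_map B G.-atlas (fun m => f m * g m)%g.
Proof.
have [Bc _ _] := Bs.
move=> sf sg; apply: (smooth_map_comp2 Bc _ _ _ sf sg (@mulg_smooth R G)).
- exact: mfd_chartP.
- exact: mfd_chartP.
- exact: chartP.
Qed.

Lemma smooth_map_invg (f : M -> G) :
  smooth_map B G.-atlas f -> smooth_map B G.-atlas (fun m => (f m)^-1)%g.
Proof.
move=> sf; apply: (smooth_map_comp Bs _ _ sf (@invg_smooth R G));
  exact: mfd_chartP.
Qed.

End SmoothOperations.

Lemma smooth_map_mulgl (a : G) : smooth_map G.-atlas G.-atlas (fun g => a * g)%g.
Proof.
have AG := @mfd_chartP R G.
by apply: smooth_map_mulg => //; [exact: smooth_map_cst|exact: smooth_map_id].
Qed.

Lemma has_velocity_unique c x y : has_velocity c x -> has_velocity c y -> x = y.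
Proof. by move=> [_ _ cx] [_ _ cy]; exact: is_derive_unique cx cy. Qed.

Lemma has_velocityE c x : has_velocity c x -> velocity1 c = x.
Proof. by move=> [_ _ cx]; rewrite /velocity1 derive1E; exact: derive_val. Qed.

Lemma phi1_img : cimg (mfd_chart (1%g : G)) (phi G 1%g).
Proof. by exists 1%g => //; exact: chart_dom. Qed.

Lemma near_psiK : \forall u \near phi G 1%g, phi G (psi G u) = u.
Proof.
have [_ oi _ _ _] := chartP (1%g : G).
have : \forall u \near phi G 1%g, cimg (mfd_chart (1%g : G)) u.
  by apply: open_nbhs_nbhs; split=> //; exact: phi1_img.
by apply: filterS => _ [g Ag <-]; rewrite chartK.
Qed.

(** Supplies a curve with prescribed velocity before any one-parameter subgroup has been
    constructed. *)
Lemma has_velocity_line x : has_velocity (fun s : R => psi G (phi G 1%g + s *: x)) x.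
Proof.
have dl : is_derive (0 : R) 1 (fun s : R => phi G 1%g + s *: x) x.
  exact: is_derive_line.
have l0 : phi G 1%g + (0 : R) *: x = phi G 1%g by rewrite scale0r addr0.
have lc := is_derive_continuous dl.
split.
- by rewrite l0 chartK//; exact: chart_dom.
- have [_ _ _ _ pc] := chartP (1%g : G).
  have pc1 : {for phi G 1%g, continuous (psi G)}.
    by apply: pc; rewrite inE; exact: phi1_img.
  by apply: (@continuous_comp _ _ _ _ (psi G) 0 lc); rewrite l0.
- apply: near_eq_is_derive dl.
  have : \forall s \near (0 : R), phi G (psi G (phi G 1%g + s *: x)) = phi G 1%g + s *: x.
    by apply: (lc (fun u => phi G (psi G u) = u)); rewrite l0; exact: near_psiK.
  by apply: filterS => s /= ->.
Qed.

(** The target chart is arbitrary, so that maps moving the unit, such as left translations, are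
    included. *)
Lemma has_velocity_curve (M : smoothManifoldType R) (f : G -> M) (y : M) c x :
  smooth_map G.-atlas M.-atlas f -> cdom (mfd_chart y) (f 1%g) ->
  has_velocity c x ->
  is_derive (0 : R) 1 (cfun (mfd_chart y) \o f \o c)
    ('D_x (cfun (mfd_chart y) \o f \o psi G) (phi G 1%g)).
Proof.
move=> sf y1 [c0 cc dc]; rewrite -c0.
apply: smooth_map_curve => //; rewrite ?c0 //; [exact: chartP|exact: chart_dom].
Qed.

Definition chart_expr (F : G * G -> G) :=
  fun u : 'rV[R]_(mfd_dim G) * 'rV[R]_(mfd_dim G) => phi G (F (psi G u.1, psi G u.2)).

(** Exactly the open set that [smooth_map] attaches to the charts at [(1, 1)] and [1], so that
    smoothness of [F] applies verbatim. *)
Definition chart_expr_dom (F : G * G -> G) :=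
  cfun (prod_atlas G.-atlas G.-atlas (1%g, 1%g)) @`
  (cdom (prod_atlas G.-atlas G.-atlas (1%g, 1%g)) `&`
   F @^-1` cdom (mfd_chart (1%g : G))).

Section ChartExpression.
Variable F : G * G -> G.
Hypothesis sF : smooth_map (prod_atlas G.-atlas G.-atlas) G.-atlas F.

Lemma open_chart_expr_dom : open (chart_expr_dom F).
Proof.
apply: open_cfun_image; first exact: prod_chartP.
have [oA _ _ _ _] := chartP (1%g : G).
by have [/continuousP Fc _] := sF; exact: Fc.
Qed.

Lemma ck_on_chart_expr k : ck_on k (chart_expr_dom F) (chart_expr F).
Proof. exact: sF.2 (1%g, 1%g) 1%g k. Qed.

Lemma chart_expr_domP (a b : G) : cdom (mfd_chart (1%g : G)) a ->
  cdom (mfd_chart (1%g : G)) b -> cdom (mfd_chart (1%g : G)) (F (a, b)) ->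
  chart_expr_dom F (phi G a, phi G b).
Proof. by move=> Aa Ab AF; exists (a, b). Qed.

Lemma is_derive_bicurve c q (t : R) x y :
  {for t, continuous c} -> {for t, continuous q} ->
  cdom (mfd_chart (1%g : G)) (c t) -> cdom (mfd_chart (1%g : G)) (q t) ->
  cdom (mfd_chart (1%g : G)) (F (c t, q t)) ->
  is_derive t 1 (phi G \o c) x -> is_derive t 1 (phi G \o q) y ->
  is_derive t 1 (fun s => phi G (F (c s, q s)))
    ('D_(x, y) (chart_expr F) (phi G (c t), phi G (q t))).
Proof.
move=> cc qc Ac Aq AF dc dq.
apply: (smooth_map_curve (x := (1%g, 1%g)) (prod_chartP (1%g, 1%g)) sF
  (c := fun s => (c s, q s))) => //.
  exact: cvg_pair.
exact: is_derive_pair.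
Qed.

End ChartExpression.

(** Multiplication by the unit on either side is the identity, so the differential of the
    multiplication at [(1, 1)] is addition. *)
Lemma has_velocityM c q x y : has_velocity c x -> has_velocity q y ->
  has_velocity (fun s => c s * q s)%g (x + y).
Proof.
move=> [c0 cc dc] [q0 qc dq].
have A1 := chart_dom (1%g : G).
split.
- by rewrite c0 q0 mulg1.
- apply: (@continuous_comp _ _ _ (fun s => (c s, q s)) (fun p : G * G => (p.1 * p.2)%g)).
    exact: cvg_pair.
  exact: (@mulg_smooth R G).1.
have := is_derive_bicurve (@mulg_smooth R G) cc qc.
rewrite /= c0 q0 mulg1 => /(_ _ _ A1 A1 A1 dc dq).
rewrite derive_pairD; last first.
  apply: (ck_on_chart_expr (@mulg_smooth R G) 1).1.
  by apply: chart_expr_domP; rewrite //= mulg1.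
by rewrite !derive_id_near //;
   apply: filterS near_psiK => u /=; rewrite /chart_expr /= chartK// ?mulg1 ?mul1g.
Qed.

Lemma has_velocity_cst : has_velocity (fun=> 1%g : G) 0.
Proof. by split; [|exact: cvg_cst|exact: is_derive_cst]. Qed.

Lemma has_velocity_comp (H : lieGroupType R) (f : G -> H) c x :
  smooth_map G.-atlas H.-atlas f -> f 1%g = 1%g -> has_velocity c x ->
  has_velocity (f \o c) ('D_x (phi H \o f \o psi G) (phi G 1%g)).
Proof.
move=> sf f1 cx; have [c0 cc _] := cx; split.
- by rewrite /= c0.
- exact: (@continuous_comp _ _ _ c f 0 cc (sf.1 _)).
- have A1 : cdom (mfd_chart (1%g : H)) (f 1%g) by rewrite f1; exact: chart_dom.
  exact: (has_velocity_curve sf A1 cx).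
Qed.

(** Smoothness of the inversion gives some velocity [y]; as [c] times its inverse is constant,
    [x + y = 0]. *)
Lemma has_velocityV c x : has_velocity c x -> has_velocity (fun s => (c s)^-1)%g (- x).
Proof.
move=> cx.
have := has_velocity_comp (f := fun g : G => g^-1%g) (@invg_smooth R G) (invg1 G) cx.
set y := 'D_x _ _ => cy.
have := has_velocityM cx cy.
have -> : (fun s => c s * ((fun g : G => g^-1%g) \o c) s)%g = (fun=> 1%g).
  by apply/funext => s; rewrite /= mulgV.
move=> /(has_velocity_unique has_velocity_cst)/esym/eqP.
by rewrite addrC addr_eq0 => /eqP yE; rewrite -yE.
Qed.

Lemma has_velocity0_comp (f : G -> G) c :
  smooth_map G.-atlas G.-atlas f -> f 1%g = 1%g -> has_velocity c 0 ->
  has_velocity (f \o c) 0.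
Proof.
by move=> sf f1 c0; have := has_velocity_comp sf f1 c0; rewrite derive0.
Qed.

(* [x] is the logarithmic derivative [c(t)^-1 c'(t)]. *)
Definition left_velocity c (t : R) x :=
  has_velocity (fun h => (c t)^-1 * c (t + h))%g x.

Lemma left_velocity_continuous c t x : left_velocity c t x -> {for t, continuous c}.
Proof.
move=> [_ cc _].
have -> : c =
    (fun g => c t * g)%g \o (fun h => (c t)^-1 * c (t + h))%g \o (fun s => s - t).
  by apply/funext => s /=; rewrite mulVKg addrC subrK.
have sc : {for t, continuous (fun s : R => s - t)}.
  by apply: cvgB; [exact: cvg_id|exact: cvg_cst].
apply: (@continuous_comp _ _ _ (fun s : R => s - t)) => //.
rewrite /= subrr; apply: (@continuous_comp _ _ _ _ (fun g => c t * g)%g) => //.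
exact: (smooth_map_mulgl (c t)).1.
Qed.

(** Since [(c t)^-1 * c z] is [((c t)^-1 * c s) * ((c s)^-1 * c z)], a left translation turns the
    logarithmic derivative at [s] into an ordinary derivative in the chart at the unit, based at the
    fixed time [t]. *)
Lemma left_velocityE c (t s : R) x : left_velocity c s x ->
  cdom (mfd_chart (1%g : G)) ((c t)^-1 * c s)%g ->
  is_derive s 1 (fun z => phi G ((c t)^-1 * c z)%g)
    ('D_x (phi G \o (fun g => (c t)^-1 * c s * g)%g \o psi G) (phi G 1%g)).
Proof.
move=> cs As.
have := has_velocity_curve (smooth_map_mulgl ((c t)^-1 * c s)%g) _ cs.
rewrite mulg1 => /(_ _ As) /is_derive_translate => /(_ s).
by under eq_fun do rewrite /= mulgA mulgK sub0r addrC subrK.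
Qed.

End LieGroupCurves.

(** * Curves with a given logarithmic derivative *)

Section Uniqueness.
Variables (R : realType) (G : lieGroupType R).
Implicit Types (c q : R -> G) (x y : 'rV[R]_(mfd_dim G)).

(** Left translation by [(c t)^-1] brings the curve near the unit, where its chart expression has
    zero derivative and is constant. *)
Lemma left_velocity0_locally_cst c (d t : R) :
  (forall t : R, `|t| < d -> left_velocity c t 0) -> `|t| < d ->
  exists2 e : R, 0 < e & forall s, `|s| < e -> c (t + s) = c t.
Proof.
move=> c0 td; have [p0 pc _] := c0 t td.
pose p s := ((c t)^-1 * c (t + s))%g.
have /nbhs_ballP[e /= e0 eP] : \forall s \near (0 : R), cdom (mfd_chart (1%g : G)) (p s).
  by apply: (pc (cdom (mfd_chart (1%g : G)))); rewrite p0; exact/chart_near/chart_dom.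
(* The bound [e] keeps the translated curve in the chart, and [d - |t|] keeps [t + s] where the
   hypothesis holds. *)
exists (Num.min e (d - `|t|)); first by rewrite lt_min e0 subr_gt0.
have pdom s : `|s| < e -> cdom (mfd_chart (1%g : G)) (p s).
  by move=> se; apply: eP; rewrite -ball_normE /= sub0r normrN.
move=> s; rewrite lt_min => /andP[se sd].
have dp (r : R) : `|r| <= `|s| -> is_derive r 1 (fun z => phi G (p z)) 0.
  move=> rs; have rd : `|t + r| < d.
    by rewrite (le_lt_trans (ler_normD _ _))// -ltrBrDl (le_lt_trans rs).
  have := left_velocityE (t := t) (c0 _ rd) (pdom _ (le_lt_trans rs se)).
  rewrite derive0 => /(is_derive_translate r).
  by under eq_fun do rewrite addrK addrC.
have pE := is_derive0_cst dp (lexx `|s|).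
have p1 : p 0 = 1%g by exact: p0.
have := congr1 (psi G) pE; rewrite !chartK; first last.
- exact: pdom.
- by rewrite p1; exact: chart_dom.
by rewrite p1 /p => /(congr1 (fun g => c t * g)%g); rewrite mulVKg mulg1.
Qed.

Lemma left_velocity0_cst c (d t : R) :
  (forall t : R, `|t| < d -> left_velocity c t 0) -> `|t| < d -> c t = c 0.
Proof.
move=> c0 td.
(* A locally constant indicator function has zero derivative, which replaces the
   connectedness of the interval. *)
pose f s : 'rV[R]_1 := if `[< c s = c 0 >] then 0 else const_mx 1.
have df (s : R) : `|s| <= `|t| -> is_derive s 1 f 0.
  move=> st; have [e e0 eP] := left_velocity0_locally_cst c0 (le_lt_trans st td).
  apply: (@near_eq_is_derive _ _ _ (cst (f s))).
  apply/nbhs_ballP; exists e => // z; rewrite -ball_normE /= distrC => zs.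
  by rewrite /f -(eP _ zs) addrC subrK.
have := is_derive0_cst df (lexx `|t|).
rewrite /f; case: asboolP => // _; rewrite asboolT// => /rowP/(_ 0).
by rewrite !mxE => /eqP; rewrite oner_eq0.
Qed.

(** The logarithmic derivative of [a * b^-1] at [s] is that of [a] minus that of [b], conjugated by
    [b s]; so it vanishes and the quotient is constant. *)
Lemma left_velocity_unique (a b : R -> G) x (d t : R) :
  (forall t : R, `|t| < d -> left_velocity a t x) ->
  (forall t : R, `|t| < d -> left_velocity b t x) ->
  `|t| < d -> (a t * (b t)^-1 = a 0 * (b 0)^-1)%g.
Proof.
move=> ax bx td; apply: (@left_velocity0_cst (fun t => a t * (b t)^-1)%g d) => // s sd.
have := has_velocityM (ax s sd) (has_velocityV (bx s sd)); rewrite subrr => ab.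
have AG := @mfd_chartP R G.
have sf : smooth_map G.-atlas G.-atlas (fun g => b s * g * (b s)^-1)%g.
  apply: smooth_map_mulg => //; first exact: smooth_map_mulgl.
  exact: smooth_map_cst.
have f1 : (b s * 1 * (b s)^-1 = 1)%g by rewrite mulg1 mulgV.
have := has_velocity0_comp sf f1 ab; rewrite /left_velocity.
congr (has_velocity _ _); apply/funext => h /=.
by rewrite !invgM !invgK !mulgA mulgK.
Qed.

Lemma one_parameter0 c : one_parameter_subgroup c -> c 0 = 1%g.
Proof.
move=> [_ cM]; have := cM 0 0; rewrite addr0 => /(congr1 (fun g => (c 0)^-1 * g)%g).
by rewrite mulKg mulVg.
Qed.

Lemma one_parameterN c t : one_parameter_subgroup c -> c (- t) = (c t)^-1%g.
Proof.
move=> c1; have [_ cM] := c1.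
by apply/esym/mulg1_eq; rewrite -cM subrr one_parameter0.
Qed.

Lemma one_parameter_velocity c : one_parameter_subgroup c ->
  has_velocity c (velocity1 c).
Proof.
move=> c1; have [[cc cs] cM] := c1; split; [exact: one_parameter0|exact: cc|].
rewrite /velocity1 derive1E; apply: derivableP; apply/derivable1_diffP.
have [d _] := cs 0 1%g 1%N; apply: d; exists 0 => //; split=> //=.
by rewrite one_parameter0//; exact: chart_dom.
Qed.

Lemma one_parameter_left_velocity c t : one_parameter_subgroup c ->
  left_velocity c t (velocity1 c).
Proof.
move=> c1; rewrite /left_velocity; have [_ cM] := c1.
by under eq_fun do rewrite cM mulKg; exact: one_parameter_velocity.
Qed.

Lemma one_parameter_unique c q :
  one_parameter_subgroup c -> one_parameter_subgroup q ->
  velocity1 c = velocity1 q -> c = q.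
Proof.
move=> c1 q1 cq; apply/funext => t.
apply: divg1_eq.
rewrite (@left_velocity_unique c q (velocity1 c) (`|t| + 1)).
- by rewrite !one_parameter0// mulgV.
- by move=> s _; exact: one_parameter_left_velocity.
- by move=> s _; rewrite cq; exact: one_parameter_left_velocity.
- by rewrite ltrDl.
Qed.

Lemma has_velocity_scale c x (a : R) :
  has_velocity c x -> has_velocity (fun s => c (s * a)) (a *: x).
Proof.
move=> [c0 cc dc].
have da : is_derive (0 : R) 1 (fun s : R => 0 + s *: a) a by exact: is_derive_line.
have aE : (fun s : R => 0 + s *: a) = (fun s => s * a).
  by apply/funext => s; rewrite add0r.
rewrite aE in da.
split.
- by rewrite mul0r.
- apply: (@continuous_comp _ _ _ (fun s : R => s * a) c).
    exact: is_derive_continuous da.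
  by rewrite mul0r.
have dc' : differentiable (phi G \o c) 0 by apply/derivable1_diffP; case: dc.
have dcE : 'D_a (phi G \o c) 0 = a *: x.
  have [_ <-] := dc.
  by rewrite !deriveE// -[X in 'd _ _ X = _](mulr1 a) -[a * 1]/(a *: 1) linearZ.
have := @is_derive_comp_curve _ _ _ (phi G \o c) (fun s : R => s * a) 0 a.
by rewrite mul0r dcE; apply.
Qed.

Lemma one_parameter_scale c (a : R) :
  one_parameter_subgroup c -> one_parameter_subgroup (fun s => c (s * a)).
Proof.
move=> [cs cM]; split; last by move=> s t; rewrite mulrDl cM.
have := smooth_curve_affine a 0 (fun g => chartP g) cs.
by under eq_fun do rewrite add0r.
Qed.

Lemma lie_exp_one_parameter c (t : R) : one_parameter_subgroup c ->
  lie_exp (t *: velocity1 c) = c t.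
Proof.
move=> c1; rewrite /lie_exp; case: xgetP => [g -> [q [q1 qE <-]]|].
  have ct1 := one_parameter_scale t c1.
  have E : velocity1 (fun s => c (s * t)) = t *: velocity1 c.
    by apply: has_velocityE; apply: has_velocity_scale; exact: one_parameter_velocity.
  have -> : q = (fun s => c (s * t)).
    by apply: one_parameter_unique => //; rewrite E.
  by rewrite mul1r.
(* The default value of [xget] is excluded: the rescaled subgroup reaches [c t] at time 1. *)
move=> /(_ (c t)) []; exists (fun s => c (s * t)); split.
- exact: one_parameter_scale.
- by apply: has_velocityE; apply: has_velocity_scale; exact: one_parameter_velocity.
- by rewrite mul1r.
Qed.

End Uniqueness.

(** * One-parameter subgroups *)

Section Existence.
Variables (R : realType) (G : lieGroupType R).
Implicit Types (c q : R -> G) (x : 'rV[R]_(mfd_dim G)).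

Let mulhat := chart_expr (fun p : G * G => (p.1 * p.2)%g).

(** The left-invariant vector field with value [x] at the unit, written in the chart there. *)
Definition left_field x (u : 'rV[R]_(mfd_dim G)) : 'rV[R]_(mfd_dim G) :=
  'D_(0, x) mulhat (u, phi G 1%g).

Lemma cimgK (u : 'rV[R]_(mfd_dim G)) : cimg (mfd_chart (1%g : G)) u ->
  cdom (mfd_chart (1%g : G)) (psi G u) /\ phi G (psi G u) = u.
Proof. by move=> [g Ag <-]; rewrite chartK. Qed.

Lemma ck_on_left_field x k : ck_on k (cimg (mfd_chart (1%g : G))) (left_field x).
Proof.
have [_ oi _ _ _] := chartP (1%g : G).
have [_ m'] := ck_on_chart_expr (@mulg_smooth R G) k.+1.
apply: (@ck_on_affine _ _ _ _ k _ _ (fun u => (u, phi G 1%g))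
  (fun v => (v, 0 : 'rV[R]_(mfd_dim G))) _ oi _ _ (m' (0, x))).
  move=> _ [g Ag <-]; apply: chart_expr_domP => //=; last by rewrite mulg1.
  exact: chart_dom.
move=> u v; have di : differentiable id u by [].
have dc : differentiable (cst (phi G 1%g) : 'rV[R]_(mfd_dim G) -> _) u by [].
split; first exact: differentiable_pair.
by rewrite (derive_pair v di dc) derive_id derive_cst.
Qed.

Lemma ode_left_velocity x (y : R -> 'rV[R]_(mfd_dim G)) (t : R) :
  cimg (mfd_chart (1%g : G)) (y t) -> is_derive t 1 y (left_field x (y t)) ->
  left_velocity (psi G \o y) t x.
Proof.
move=> iy dy; have yc := is_derive_continuous dy.
have [_ oi _ _ pc] := chartP (1%g : G).
have [Aa ya] := cimgK iy; set a := psi G (y t) in Aa ya.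
have gc : {for t, continuous (psi G \o y)}.
  by apply: (@continuous_comp _ _ _ y (psi G)) => //; apply: pc; rewrite inE.
have near_y : \forall s \near t, cimg (mfd_chart (1%g : G)) (y s).
  by apply: (yc (cimg (mfd_chart (1%g : G)))); exact: open_nbhs_nbhs.
have dg : is_derive t 1 (phi G \o (psi G \o y)) (left_field x (y t)).
  by apply: near_eq_is_derive dy; apply: filterS near_y => s /cimgK[_ /= ->].
have A1 := chart_dom (1%g : G).
have la := smooth_map_mulgl a^-1%g.
have a1 : cdom (mfd_chart (1%g : G)) (a^-1 * a)%g by rewrite mulVg.
have dgl := smooth_map_curve (f := fun g : G => (a^-1 * g)%g) (chartP 1%g) la gc Aa a1 dg.
pose c0 s := psi G (phi G 1%g + s *: x).
(* The curves [y] and [a c0] have the same velocity at [a]; translating the second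
   one back to the unit gives [c0], whose velocity is [x]. *)
have [l0 lc dl] : has_velocity c0 x := has_velocity_line x.
have dac : is_derive (0 : R) 1 (phi G \o (fun s => a * c0 s)%g) (left_field x (y t)).
  have := is_derive_bicurve (c := cst a) (q := c0) (@mulg_smooth R G) (t := 0).
  move=> /(_ 0 x); rewrite /= l0 mulg1 ya; apply=> //.
  - exact: cvg_cst.
  - exact: (is_derive_cst (phi G a) (0 : R) 1).
have ac : {for 0, continuous (fun s => a * c0 s)%g}.
  exact: (@continuous_comp _ _ _ c0 (fun g => a * g)%g 0 lc ((smooth_map_mulgl a).1 _)).
have ac0 : (a * c0 0 = a)%g by rewrite l0 mulg1.
have zx : x =
    'D_(left_field x (y t)) (phi G \o (fun g : G => a^-1 * g)%g \o psi G) (phi G a).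
  have := smooth_map_curve (f := fun g : G => (a^-1 * g)%g) (c := fun s => (a * c0 s)%g)
    (t := 0) (chartP 1%g) la ac.
  rewrite ac0 => /(_ 1%g _ Aa a1 dac).
  have -> : phi G \o (fun g : G => a^-1 * g)%g \o (fun s => a * c0 s)%g = phi G \o c0.
    by apply/funext => s /=; rewrite mulKg.
  exact: is_derive_unique dl.
split.
- by rewrite addr0 mulVg.
- have sc : {for 0, continuous (fun h : R => t + h)}.
    by apply: cvgD; [exact: cvg_cst|exact: cvg_id].
  apply: (@continuous_comp _ _ _ _ (fun g => a^-1 * g)%g).
    by apply: (@continuous_comp _ _ _ (fun h : R => t + h)) => //; rewrite /= addr0.
  exact: la.1.
- rewrite [X in is_derive _ _ _ X]zx -[phi G a]/(phi G ((psi G \o y) t)).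
  have := is_derive_translate 0 dgl; rewrite subr0.
  by congr (is_derive _ _ _ _); apply/funext => h; rewrite /= addrC.
Qed.

Lemma local_one_parameter x : exists (d : R) (y : R -> 'rV[R]_(mfd_dim G)),
  [/\ 0 < d, y 0 = phi G 1%g &
    forall t : R, `|t| < d -> [/\ cimg (mfd_chart (1%g : G)) (y t),
      is_derive t 1 y (left_field x (y t)) & left_velocity (psi G \o y) t x]].
Proof.
have [_ oi _ _ _] := chartP (1%g : G).
have [d [y [d0 y0 dy]]] := ode_local oi (ck_on_left_field x 1) (phi1_img G).
exists d, y; split=> // t /dy[iy dyt]; split=> //.
exact: ode_left_velocity.
Qed.

End Existence.

(** The extension is [g (t / n) ^+ n] for any [n] large enough to bring [t / n] into the domain of
    additivity. *)
Lemma local_hom_extension (R : realType) (G : groupType) (g : R -> G) (r : R) :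
  0 < r ->
  (forall s t, `|s| < r -> `|t| < r -> g (s + t) = (g s * g t)%g) ->
  exists c : R -> G, (forall s t, c (s + t) = (c s * c t)%g) /\
    forall t, `|t| < r -> c t = g t.
Proof.
move=> r0 gM.
have g0 : g 0 = 1%g.
  have := gM 0 0; rewrite normr0 addr0 => /(_ r0 r0) /(congr1 (fun h => (g 0)^-1 * h)%g).
  by rewrite mulKg mulVg.
have gX (u : R) k : `|u| * k%:R < r -> g (u * k%:R) = (g u ^+ k)%g.
  elim: k => [|k IH] ukr; first by rewrite mulr0 g0.
  have k0 : 0 <= `|u| * k%:R by rewrite mulr_ge0.
  have uk : `|u| * k.+1%:R = `|u| * k%:R + `|u| by rewrite -natr1 mulrDr mulr1.
  rewrite uk in ukr.
  have ukr' : `|u| * k%:R < r by rewrite (le_lt_trans _ ukr)// lerDl.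
  rewrite -natr1 mulrDr mulr1 gM ?IH ?expgSr//.
    by rewrite normrM (@ger0_norm _ k%:R).
  by rewrite (le_lt_trans _ ukr)// lerDr.
(* The condition that [n] steps are enough, namely [|t / n| < r], written without division. *)
pose ok (t : R) (n : nat) := (0 < n)%N && (`|t| < r * n%:R).
have ok_div t n : ok t n -> `|t / n%:R| < r.
  by move=> /andP[n0 tn]; rewrite normrM normfV (@ger0_norm _ n%:R)// ltr_pdivrMr// ltr0n.
have okM t n m : ok t n -> ok t m ->
    (g (t / n%:R)%R ^+ n = g (t / m%:R)%R ^+ m)%g.
  (* Two numbers of steps are compared through their common refinement [a * b]. *)
  have aux a b : ok t a -> ok t b ->
      (g (t / a%:R)%R ^+ a = g (t / (a * b)%:R)%R ^+ (a * b))%g.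
    move=> oa /andP[b0 _]; have /andP[a0 _] := oa.
    have a0' : (a%:R : R) != 0 by rewrite pnatr_eq0 -lt0n.
    have b0' : (b%:R : R) != 0 by rewrite pnatr_eq0 -lt0n.
    have E : t / a%:R = t / (a * b)%:R * b%:R.
      by rewrite natrM invfM mulrA -[RHS]mulrA mulVf// mulr1.
    rewrite [in LHS]E gX ?expgnA 1?expgnAC//.
    have := ok_div _ _ oa; rewrite [in X in X -> _]E normrM.
    by rewrite (@ger0_norm _ b%:R).
  by move=> on om; rewrite (aux n m)// (aux m n)// mulnC.
have ex_ok t : exists n, ok t n.
  exists (Num.truncn (`|t| / r)).+1; rewrite /ok /= mulrC -ltr_pdivrMr//.
  by rewrite truncnS_gt.
have /choice[N NP] := ex_ok.
(* [okM] makes the value independent of the number [N t] of steps. *)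
exists (fun t => g (t / (N t)%:R)%R ^+ N t)%g; split=> [s t|t tr]; last first.
  have o1 : ok t 1 by rewrite /ok mulr1.
  by rewrite (okM _ _ _ (NP t) o1) divr1 expg1.
(* One number of steps that serves [s], [t] and [s + t] at once. *)
have [n nP] := ex_ok (`|s| + `|t|).
have /andP[n0] := nP; rewrite ger0_norm ?addr_ge0// => stn.
have os : ok s n by rewrite /ok n0 (le_lt_trans _ stn)// lerDl.
have ot : ok t n by rewrite /ok n0 (le_lt_trans _ stn)// lerDr.
have ost : ok (s + t) n by rewrite /ok n0 (le_lt_trans _ stn)// ler_normD.
rewrite (okM _ _ _ (NP s) os) (okM _ _ _ (NP t) ot) (okM _ _ _ (NP _) ost).
have [sr tr] := (ok_div _ _ os, ok_div _ _ ot).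
(* Both products equal [g] of the same sum; commutation lets the power distribute over the
   product. *)
have cst : commute (g (s / n%:R)) (g (t / n%:R)).
  by rewrite /commute -!gM// addrC.
by rewrite -expgMn// -gM// mulrDl.
Qed.

Section OneParameter.
Variables (R : realType) (G : lieGroupType R).
Implicit Types (c q : R -> G) (x : 'rV[R]_(mfd_dim G)).

(** Bootstrap: the derivative of [y] is [F \o y], which is as regular as [y] itself, so each step of
    the induction gains one order. *)
Lemma ck_on_ode n k (D : set R) (U : set 'rV[R]_n) (F : 'rV[R]_n -> 'rV[R]_n)
    (y : R -> 'rV[R]_n) : open D ->
  (forall k, ck_on k U F) ->
  (forall t : R, D t -> U (y t) /\ is_derive t 1 y (F (y t))) ->
  ck_on k D y.
Proof.
move=> oD Fk yD; elim: k => [|k IH].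
  by move=> t /yD[_ /is_derive_continuous].
have yd t : D t -> differentiable y t.
  by move=> /yD[_ [/derivable1_diffP]].
split=> // v.
have Fy : ck_on k D (F \o y) by apply: ck_on_comp (Fk k) => // t /yD[].
apply: (ck_on_eq oD _ (ck_onZ oD (ck_on_cst k D (v : R)) Fy)) => t Dt /=.
have dy := yd _ Dt; have [_ [_ <-]] := yD _ Dt.
by rewrite !deriveE// -[in RHS](mulr1 v) -[v * 1]/(v *: 1) linearZ.
Qed.

(** The curves [t |-> g (s + t)] and [g] have the same logarithmic derivative, so their quotient
    keeps its value [g s] at time 0. Halving [d] keeps [s + t] in range. *)
Lemma local_hom (g : R -> G) (d : R) x :
  (forall t : R, `|t| < d -> left_velocity g t x) -> g 0 = 1%g ->
  forall s t, `|s| < d / 2 -> `|t| < d / 2 -> g (s + t) = (g s * g t)%g.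
Proof.
move=> gx g0 s t sd td.
have d2 (z : R) : `|z| < d / 2 -> `|z| < d.
  by move=> zd; have := normr_ge0 z; move: zd; lra.
have := @left_velocity_unique R G (fun t => g (s + t)) g x (d / 2) t.
rewrite addr0 g0 invg1 mulg1 => <-//; last by move=> z /d2; exact: gx.
  by rewrite mulgVK.
move=> z zd; rewrite /left_velocity.
under eq_fun do rewrite addrA.
apply: gx; rewrite (le_lt_trans (ler_normD _ _))//.
by move: zd sd; lra.
Qed.

Lemma has_velocity_near c q x : (\forall t \near (0 : R), c t = q t) ->
  has_velocity c x -> has_velocity q x.
Proof.
move=> cq [c0 cc dc]; have cq0 := nbhs_singleton cq; split.
- by rewrite -cq0.
- by rewrite /prop_for /continuous_at -cq0; apply: cvg_trans cc; exact: near_eq_cvg.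
- by apply: near_eq_is_derive dc; apply: filterS cq => t /= ->.
Qed.

(** The local integral curve of the left-invariant field is a local homomorphism, hence extends to
    the whole line; smoothness at any time is carried over from time 0 by a left translation. *)
Lemma one_parameter_exists x :
  exists2 c, one_parameter_subgroup c & velocity1 c = x.
Proof.
have [d [y [d0 y0 yP]]] := local_one_parameter x.
pose g := psi G \o y.
have g0 : g 0 = 1%g by rewrite /g /= y0 chartK//; exact: chart_dom.
have gx (t : R) : `|t| < d -> left_velocity g t x by move=> /yP[].
have r0 : 0 < d / 2 by rewrite divr_gt0.
have [c [cM cg]] := local_hom_extension r0 (local_hom gx g0).
have r_d (z : R) : `|z| < d / 2 -> `|z| < d.
  by move=> zd; have := normr_ge0 z; move: zd; lra.
have near_r : \forall t \near (0 : R), `|t| < d / 2.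
  by apply/nbhs_ballP; exists (d / 2) => // t; rewrite -ball_normE /= sub0r normrN.
have vc : has_velocity c x.
  have := gx 0; rewrite normr0 => /(_ d0); apply: has_velocity_near.
  by apply: filterS near_r => t tr; rewrite g0 invg1 mul1g add0r cg.
have lc t : left_velocity c t x.
  by rewrite /left_velocity; under eq_fun do rewrite cM mulKg.
exists c; last exact: has_velocityE.
split=> //; split=> [t|z0 y1 k]; first exact: left_velocity_continuous (lc t).
have cc : continuous c by move=> t; exact: left_velocity_continuous (lc t).
apply: ck_on_local => _ [t0 [_ At0] <-].
(* On this window [c t = c t0 * g (t - t0)], a left translate of the local solution shifted in
   time. *)
pose D := [set t | `|t - t0| < d / 2] `&` c @^-1` cdom (mfd_chart y1).
exists D; first by split=> //=; rewrite subrr normr0.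
have oD : open D.
  apply: openI; last by move/continuousP : cc; apply; have [] := chartP y1.
  have -> : [set t | `|t - t0| < d / 2] = ball t0 (d / 2).
    by apply/seteqP; split=> t; rewrite -ball_normE /= distrC.
  exact: ball_open.
pose B := [set t : R | `|t| < d / 2].
have oB : open B.
  have -> : B = ball 0 (d / 2).
    by apply/seteqP; split=> t; rewrite -ball_normE /= sub0r normrN.
  exact: ball_open.
have yk : ck_on k B y.
  by apply: (ck_on_ode k oB (ck_on_left_field x)) => t /r_d /yP[].
have ysk : ck_on k D (y \o (fun t => - t0 + t * 1)).
  apply: (ck_on_affine oD _ (fun t v => derive_affine 1 (- t0) t v) yk).
  by move=> t [td _]; rewrite /B /= mulr1 addrC.
apply: (ck_on_eq oD _ (ck_on_comp oD _ ysk ((smooth_map_mulgl (c t0)).2 1%g y1 k))).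
- move=> t [/= td _] /=; congr (cfun _ _).
  by rewrite mulr1 addrC -[psi G _]/(g (t - t0)) -(cg _ td) -cM addrCA subrr addr0.
- move=> t [/= td ct] /=; rewrite mulr1 addrC.
  have [/cimgK[Ag gE] _ _] := yP _ (r_d _ td).
  exists (psi G (y (t - t0))) => //; split=> //=.
  by rewrite -[psi G _]/(g (t - t0)) -(cg _ td) -cM addrCA subrr addr0.
Qed.

Lemma lie_exp_curve x : one_parameter_subgroup (fun t => lie_exp (t *: x)) /\
  has_velocity (fun t => lie_exp (t *: x)) x.
Proof.
have [c c1 cx] := one_parameter_exists x.
have -> : (fun t => lie_exp (t *: x)) = c.
  by apply/funext => t; rewrite -cx; exact: lie_exp_one_parameter.
by split=> //; rewrite -cx; exact: one_parameter_velocity.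
Qed.

End OneParameter.

(** * Tangent maps at the unit *)

Section Differentiation.
Variables (R : realType).

Section Hom.
Variables (G H : lieGroupType R) (f : G -> H).
Hypothesis sf : smooth_map G.-atlas H.-atlas f.
Hypothesis f1 : f 1%g = 1%g.

Lemma tangent_mapE x : tangent_map f 1%g x = 'D_x (phi H \o f \o psi G) (phi G 1%g).
Proof.
rewrite /tangent_map f1 deriveE//.
have [d _] := sf.2 1%g 1%g 1%N; apply: d; exists 1%g => //; split.
  exact: chart_dom.
by rewrite /preimage /= f1; exact: chart_dom.
Qed.

Lemma tangent_map_velocity c x : has_velocity c x ->
  has_velocity (f \o c) (tangent_map f 1%g x).
Proof. by rewrite tangent_mapE; exact: has_velocity_comp. Qed.

End Hom.

(** * The mixed derivative of a family of endomorphisms *)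

Section Mixed.
Variables (G : lieGroupType R) (F : G * G -> G).

(* For [F (a, b) = a b a^-1] these are [Ad a y] and [ad x y = [x, y]]. *)
Definition inner_derivative (a : G) (y : 'rV[R]_(mfd_dim G)) : 'rV[R]_(mfd_dim G) :=
  velocity1 (fun s : R => F (a, lie_exp (s *: y))).

Definition mixed_derivative (x y : 'rV[R]_(mfd_dim G)) : 'rV[R]_(mfd_dim G) :=
  derive1 (fun t : R => inner_derivative (lie_exp (t *: x)) y) 0.

Hypothesis sF : smooth_map (prod_atlas G.-atlas G.-atlas) G.-atlas F.
Let e := phi G 1%g.

(** With a constant [w] this differentiates [inner_derivative] in its group argument; a moving [w]
    occurs in the proof of the second post-Lie axiom. *)
Lemma is_derive_partialr c x (w : R -> 'rV[R]_(mfd_dim G)) w' :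
  chart_expr_dom F (e, e) ->
  has_velocity c x -> is_derive (0 : R) 1 w w' ->
  is_derive (0 : R) 1 (fun t => 'D_(0, w t) (chart_expr F) (phi G (c t), e))
    ('D_(x, 0) (fun z => 'D_(0, w 0) (chart_expr F) z) (e, e)
     + 'D_(0, w') (chart_expr F) (e, e)).
Proof.
move=> We [c0 cc dc] dw.
have dp : is_derive (0 : R) 1 (fun t => (phi G (c t), e)) (x, 0).
  by apply: is_derive_pair => //; exact: (is_derive_cst e (0 : R) 1).
have p0 : (phi G (c 0), e) = (e, e) by rewrite c0.
have := is_derive_derive_along (linr _ _ _) (open_chart_expr_dom sF)
  (ck_on_chart_expr sF 2) _ dw dp.
by rewrite /= p0; apply.
Qed.

Hypothesis F1 : forall a, F (a, 1%g) = 1%g.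

Lemma smooth_map_partial a : smooth_map G.-atlas G.-atlas (fun b => F (a, b)).
Proof.
apply: (smooth_map_comp2 _ _ _ _ (smooth_map_cst _ _ a) (smooth_map_id _) sF) => //;
  solve [exact: mfd_chartP | exact: chartP].
Qed.

(** Frees [inner_derivative] from the exponential curve of its definition: the velocity of the image
    depends on [c] only through [y]. *)
Lemma inner_velocity a c y : has_velocity c y ->
  has_velocity (fun s => F (a, c s)) (inner_derivative a y).
Proof.
move=> cy.
have cF := has_velocity_comp (smooth_map_partial a) (F1 a) cy.
have := has_velocity_comp (smooth_map_partial a) (F1 a) (lie_exp_curve y).2.
by move/has_velocityE; rewrite /inner_derivative => ->.
Qed.

Lemma inner_tangent_map a y :
  inner_derivative a y = tangent_map (fun b => F (a, b)) 1%g y.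
Proof.
rewrite (tangent_mapE (smooth_map_partial a) (F1 a)).
exact/has_velocityE/(has_velocity_comp (smooth_map_partial a) (F1 a))/(lie_exp_curve y).2.
Qed.

Lemma inner_derivative_linear a : linear (inner_derivative a).
Proof. by move=> k y z; rewrite !inner_tangent_map /tangent_map linearP. Qed.

Lemma chart_expr_dom1 a : cdom (mfd_chart (1%g : G)) a ->
  chart_expr_dom F (phi G a, e).
Proof. by move=> Aa; apply: chart_expr_domP => //; rewrite ?F1; exact: chart_dom. Qed.

Lemma inner_derivativeE a y : cdom (mfd_chart (1%g : G)) a ->
  inner_derivative a y = 'D_(0, y) (chart_expr F) (phi G a, e).
Proof.
move=> Aa; have [e0 ec ed] := (lie_exp_curve y).2.
have A1 := chart_dom (1%g : G).
have cc : {for 0, continuous (cst a : R -> G)} by exact: cvg_cst.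
have := is_derive_bicurve sF cc ec.
move=> /(_ 0 y); rewrite e0 F1 => /(_ Aa A1 A1).
move=> /(_ (is_derive_cst (phi G a) (0 : R) 1) ed).
by move=> aD; rewrite /inner_derivative /velocity1 derive1E; case: aD.
Qed.

Lemma near_dom c x : has_velocity c x ->
  \forall t \near (0 : R), cdom (mfd_chart (1%g : G)) (c t).
Proof.
move=> [c0 cc _]; apply: (cc (cdom (mfd_chart (1%g : G)))).
by rewrite c0; exact/chart_near/chart_dom.
Qed.

Lemma is_derive_inner_derivative c x y : has_velocity c x ->
  is_derive (0 : R) 1 (fun t => inner_derivative (c t) y)
    ('D_(x, 0) (fun z => 'D_(0, y) (chart_expr F) z) (e, e)).
Proof.
move=> cx.
have We := chart_expr_dom1 (chart_dom 1%g).
have := is_derive_partialr We cx (is_derive_cst y (0 : R) 1).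
rewrite derive0 addr0; apply: near_eq_is_derive.
by apply: filterS (near_dom cx) => t At; rewrite inner_derivativeE.
Qed.

Lemma mixed_derivativeE x y :
  mixed_derivative x y = 'D_(x, 0) (fun z => 'D_(0, y) (chart_expr F) z) (e, e).
Proof.
rewrite /mixed_derivative derive1E.
by case: (is_derive_inner_derivative y (lie_exp_curve x).2).
Qed.

Lemma is_derive_mixed c x y : has_velocity c x ->
  is_derive (0 : R) 1 (fun t => inner_derivative (c t) y) (mixed_derivative x y).
Proof. by rewrite mixed_derivativeE; exact: is_derive_inner_derivative. Qed.

(** Linearity in [y] comes from that of [inner_derivative]; linearity in [x] holds because
    [mixed_derivativeE] makes it the direction of a derivative of a differentiable function. *)
Lemma mixed_derivative_bilinear : is_bilinear mixed_derivative.
Proof.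
have [_ dF] := ck_on_chart_expr sF 2.
have We : chart_expr_dom F (e, e) by exact/chart_expr_dom1/chart_dom.
split=> [x|y] k u v.
- have [du dv] := (is_derive_mixed u (lie_exp_curve x).2,
                   is_derive_mixed v (lie_exp_curve x).2).
  apply: is_derive_unique (is_derive_mixed _ (lie_exp_curve x).2) _.
  under eq_fun do rewrite inner_derivative_linear.
  exact: (is_deriveD (is_deriveZ k du) dv).
- rewrite !mixed_derivativeE !deriveE; try exact: (dF _).1.
  by rewrite -linearP; congr ('d _ _ _); apply: injective_projections;
    rewrite /= ?scaler0 ?addr0.
Qed.

End Mixed.

(** Differentiating the intertwining relation in [b] shows that the tangent map commutes with
    [inner_derivative]; being linear, it then passes through the derivative in [a]. *)
Lemma mixed_derivative_hom (G H : lieGroupType R) (f : G -> H)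
    (FG : G * G -> G) (FH : H * H -> H) :
  smooth_map (prod_atlas G.-atlas G.-atlas) G.-atlas FG ->
  smooth_map (prod_atlas H.-atlas H.-atlas) H.-atlas FH ->
  (forall a, FG (a, 1%g) = 1%g) -> (forall a, FH (a, 1%g) = 1%g) ->
  smooth_map G.-atlas H.-atlas f -> f 1%g = 1%g ->
  (forall a b, f (FG (a, b)) = FH (f a, f b)) ->
  forall x y, tangent_map f 1%g (mixed_derivative FG x y) =
    mixed_derivative FH (tangent_map f 1%g x) (tangent_map f 1%g y).
Proof.
move=> sFG sFH FG1 FH1 sf f1 fF x y.
have inner a : tangent_map f 1%g (inner_derivative FG a y) =
    inner_derivative FH (f a) (tangent_map f 1%g y).
  have ey := (lie_exp_curve y).2.
  have A := tangent_map_velocity sf f1 (inner_velocity sFG FG1 a ey).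
  have := inner_velocity sFH FH1 (f a) (tangent_map_velocity sf f1 ey).
  under eq_fun do rewrite -fF.
  exact: has_velocity_unique.
have ex := (lie_exp_curve x).2.
have A := is_derive_mixed sFG FG1 y ex.
have := is_derive_mixed sFH FH1 (tangent_map f 1%g y) (tangent_map_velocity sf f1 ex).
under eq_fun do rewrite -inner.
apply: is_derive_unique.
exact: (is_derive_lin ('d (cfun (mfd_chart (f 1%g)) \o f \o cinv (mfd_chart (1%g : G)))
  (cfun (mfd_chart (1%g : G)) 1%g)) A).
Qed.

End Differentiation.

(** * Bracket and post-Lie product *)

Lemma leibniz_is_lie_algebra (R : realType) (g : lmodType R) (br : g -> g -> g) :
  is_bilinear br -> (forall x, br x x = 0) ->
  (forall x y z, br x (br y z) = br (br x y) z + br y (br x z)) ->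
  is_lie_algebra br.
Proof.
move=> [l r] brxx leib; split=> // x y z.
have lD u v w : br u (v + w) = br u v + br u w by have := l u 1 v w; rewrite !scale1r.
have rD u v w : br (u + v) w = br u w + br v w by have := r w 1 u v; rewrite !scale1r.
have anti u v : br u v = - br v u.
  have := brxx (u + v); rewrite rD !lD !brxx add0r addr0 => /eqP.
  by rewrite addr_eq0 => /eqP.
have br0 u : br u 0 = 0 by apply: (@addrI _ (br u 0)); rewrite -lD !addr0.
have N u v : br u (- v) = - br u v.
  by apply/eqP; rewrite -addr_eq0 -lD addNr br0.
by rewrite leib (anti z (br x y)) (anti z x) N addrK subrr.
Qed.

Section Bracket.
Variables (R : realType) (G : lieGroupType R).
Implicit Types x y z : 'rV[R]_(mfd_dim G).

Definition conj_pair (H : lieGroupType R) (p : H * H) : H := (p.1 * p.2 * p.1^-1)%g.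
Definition mul_pair (p : G * G) : G := (p.1 * p.2)%g.

Lemma smooth_conj_pair (H : lieGroupType R) :
  smooth_map (prod_atlas H.-atlas H.-atlas) H.-atlas (@conj_pair H).
Proof.
have AH := @mfd_chartP R H; have AHH := is_smooth_atlas_prod AH AH.
have s1 := smooth_map_fst AH (fun y : H => chartP y).
have s2 := smooth_map_snd (fun y : H => chartP y) AH.
by apply: smooth_map_mulg => //; [exact: smooth_map_mulg|exact: smooth_map_invg].
Qed.

Lemma conj_pair1 (H : lieGroupType R) (a : H) : conj_pair (a, 1%g) = 1%g.
Proof. by rewrite /conj_pair /= mulg1 mulgV. Qed.

Lemma lie_bracketE (H : lieGroupType R) (x y : 'rV[R]_(mfd_dim H)) :
  lie_bracket x y = mixed_derivative (@conj_pair H) x y.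
Proof.
have eN t : lie_exp (- t *: x) = (lie_exp (t *: x))^-1%g.
  exact: (one_parameterN t (lie_exp_curve x).1).
rewrite /lie_bracket /mixed_derivative /inner_derivative /conj_pair /=.
by under eq_fun do under eq_fun do rewrite eN.
Qed.

Lemma lie_bracket_bilinear : is_bilinear (@lie_bracket R G).
Proof.
have [l r] := mixed_derivative_bilinear (@smooth_conj_pair G) (@conj_pair1 G).
split=> [x|y] k u v; rewrite !lie_bracketE; first exact: l.
exact: r.
Qed.

(** The points of a one-parameter subgroup commute, so the conjugation fixes the curve and its inner
    derivative is constant. *)
Lemma lie_bracketxx x : lie_bracket x x = 0.
Proof.
have [[_ eM] ev] := lie_exp_curve x.
rewrite lie_bracketE; apply: (is_derive_unique
  (is_derive_mixed (@smooth_conj_pair G) (@conj_pair1 G) x ev)).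
have -> : (fun t => inner_derivative (@conj_pair G) (lie_exp (t *: x)) x) = cst x.
  apply/funext => t; apply: has_velocityE.
  have -> // : (fun s : R => conj_pair (lie_exp (t *: x), lie_exp (s *: x)))
          = (fun s => lie_exp (s *: x)).
  apply/funext => s; rewrite /conj_pair /=.
  by rewrite -(eM t s) addrC (eM s t) mulgK.
exact: (is_derive_cst x (0 : R) 1).
Qed.

(** * The Leibniz rule for actions by endomorphisms *)

Section Derivation.
Variable F : G * G -> G.
Hypothesis sF : smooth_map (prod_atlas G.-atlas G.-atlas) G.-atlas F.
Hypothesis FM : forall a b c, F (a, b * c)%g = (F (a, b) * F (a, c))%g.
Hypothesis F1r : forall a, F (a, 1%g) = 1%g.
Hypothesis F1l : forall b, F (1%g, b) = b.

Lemma inner_derivative1 y : inner_derivative F 1%g y = y.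
Proof.
rewrite /inner_derivative; under eq_fun do rewrite F1l.
exact/has_velocityE/(lie_exp_curve y).2.
Qed.

(** The endomorphism [F (a, -)] commutes with conjugation, so naturality applies to it. *)
Lemma inner_derivative_bracket a y z : inner_derivative F a (lie_bracket y z) =
  lie_bracket (inner_derivative F a y) (inner_derivative F a z).
Proof.
have FV b : F (a, b^-1%g) = (F (a, b))^-1%g.
  by apply/esym/mulg1_eq; rewrite -FM mulgV.
rewrite !(inner_tangent_map sF F1r) !lie_bracketE.
apply: (mixed_derivative_hom (@smooth_conj_pair G) (@smooth_conj_pair G)
  (@conj_pair1 G) (@conj_pair1 G) (smooth_map_partial sF a)) => // b c.
by rewrite /conj_pair /= !FM FV.
Qed.

(** The derivative of the previous identity at [a = 1], where [inner_derivative] is the identity. *)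
Lemma mixed_derivative_bracket x y z :
  mixed_derivative F x (lie_bracket y z) =
  lie_bracket (mixed_derivative F x y) z + lie_bracket y (mixed_derivative F x z).
Proof.
have ex := (lie_exp_curve x).2; have [e0 _ _] := ex.
have [l r] := lie_bracket_bilinear.
have D w := is_derive_mixed sF F1r w ex.
apply: (is_derive_unique (D _)).
under eq_fun do rewrite inner_derivative_bracket.
have I w : inner_derivative F (lie_exp ((0 : R) *: x)) w = w.
  by rewrite e0; exact: inner_derivative1.
pose A w (t : R) := inner_derivative F (lie_exp (t *: x)) w.
exact: (@is_derive_bilin R _ _ (@lie_bracket R G) (A y) (A z) 0 _ _ y z l r
  (I y) (I z) (D y) (D z)).
Qed.

End Derivation.

Lemma lie_bracket_lie_algebra : is_lie_algebra (@lie_bracket R G).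
Proof.
apply: leibniz_is_lie_algebra => [||x y z]; first exact: lie_bracket_bilinear.
  exact: lie_bracketxx.
have := mixed_derivative_bracket (@smooth_conj_pair G) _ (@conj_pair1 G) _ x y z.
rewrite -!lie_bracketE; apply.
- by move=> a b c; rewrite /conj_pair /= !mulgA mulgVK.
- by move=> b; rewrite /conj_pair /= mul1g invg1 mulg1.
Qed.

Let e := phi G 1%g.

Let mulhat := chart_expr mul_pair.
(** The mixed second derivative of the multiplication at the unit. It depends on the chart; only its
    antisymmetrization, the bracket, is intrinsic. *)
Let beta x y := 'D_(x, 0) (fun p => 'D_(0, y) mulhat p) (e, e).

Let smul : smooth_map (prod_atlas G.-atlas G.-atlas) G.-atlas mul_pair :=
  @mulg_smooth R G.

Lemma mul_domr a : cdom (mfd_chart (1%g : G)) a ->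
  chart_expr_dom mul_pair (phi G a, e).
Proof.
move=> Aa; apply: chart_expr_domP => //; rewrite /mul_pair /= ?mulg1//.
exact: chart_dom.
Qed.

Lemma near_mulhat_1l : \forall u \near e, mulhat (e, u) = u.
Proof.
apply: filterS (near_psiK G) => u uE.
by rewrite /mulhat /chart_expr /mul_pair /= chartK ?mul1g//; exact: chart_dom.
Qed.

Lemma near_mulhat_1r : \forall u \near e, mulhat (u, e) = u.
Proof.
apply: filterS (near_psiK G) => u uE.
by rewrite /mulhat /chart_expr /mul_pair /= chartK ?mulg1//; exact: chart_dom.
Qed.

Lemma derive_mulhat1r x : 'D_(0, x) mulhat (e, e) = x.
Proof. by rewrite derive_pairr derive_id_near//; exact: near_mulhat_1l. Qed.

Lemma derive_mulhat1l x : 'D_(x, 0) mulhat (e, e) = x.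
Proof. by rewrite derive_pairl derive_id_near//; exact: near_mulhat_1r. Qed.

(* Differentiates [(a b a^-1) a = a b] at [b = 1], then at [a = 1]. *)
Lemma lie_bracket_beta x y : lie_bracket x y = beta x y - beta y x.
Proof.
have ex := (lie_exp_curve x).2; have ey := (lie_exp_curve y).2.
pose c t := lie_exp (t *: x); have [c0 cc dc] : has_velocity c x := ex.
pose w t := inner_derivative (@conj_pair G) (c t) y.
have dw : is_derive (0 : R) 1 w (lie_bracket x y).
  rewrite lie_bracketE.
  exact: (is_derive_mixed (@smooth_conj_pair G) (@conj_pair1 G) y ex).
have w0 : w 0 = y.
  rewrite /w c0; apply: inner_derivative1 => b.
  by rewrite /conj_pair /= mul1g invg1 mulg1.
have A1 := chart_dom (1%g : G).
have oW := open_chart_expr_dom smul; have mk := ck_on_chart_expr smul 2.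
have We : chart_expr_dom mul_pair (e, e) by exact: mul_domr.
have near_eq : \forall t \near (0 : R),
    'D_(w t, 0) mulhat (e, phi G (c t)) = 'D_(0, y) mulhat (phi G (c t), e).
  apply: filterS (near_dom ex) => t At.
  have [q0 qc dq] := inner_velocity (@smooth_conj_pair G) (@conj_pair1 G) (c t) ey.
  have [y0 yc dy] := ey.
  have kc : {for 0, continuous (cst (c t) : R -> G)} by exact: cvg_cst.
  have kd := is_derive_cst (phi G (c t)) (0 : R) 1.
  have := is_derive_bicurve smul qc kc; rewrite /mul_pair /= q0 mul1g.
  move=> /(_ _ 0 A1 At At dq kd) D1.
  have := is_derive_bicurve smul kc yc; rewrite /mul_pair /= y0 mulg1.
  move=> /(_ 0 _ At A1 At kd dy) D2.
  apply: is_derive_unique D1 _; move: D2.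
  by under [X in _ -> is_derive _ _ X _]eq_fun do rewrite /conj_pair /= mulgVK.
have dp : is_derive (0 : R) 1 (fun t => (e, phi G (c t))) (0, x).
  by apply: is_derive_pair => //; exact: (is_derive_cst e (0 : R) 1).
have p0 : (e, phi G (c 0)) = (e, e) by rewrite c0.
have := is_derive_derive_along (linl _ _ _) oW mk _ dw dp.
rewrite /= p0 w0 => /(_ We) D1.
have D2 : is_derive (0 : R) 1 (fun t => 'D_(0, y) mulhat (phi G (c t), e)) (beta x y).
  have := is_derive_partialr smul We ex (is_derive_cst y (0 : R) 1).
  by rewrite derive0 addr0.
have := is_derive_unique (near_eq_is_derive near_eq D1) D2.
(* Symmetry of second derivatives identifies the contribution of the moving base point as
   [beta y x]; the moving direction contributes the bracket. *)
rewrite (schwarz_rV (0, x) (y, 0) oW mk We) => <-.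
by rewrite derive_mulhat1l [X in _ = X - _]addrC addrK.
Qed.

(** * The second post-Lie axiom *)

Section Curvature.
Variable F : G * G -> G.
Hypothesis sF : smooth_map (prod_atlas G.-atlas G.-atlas) G.-atlas F.
Hypothesis F1r : forall a, F (a, 1%g) = 1%g.
Hypothesis F1l : forall b, F (1%g, b) = b.
Hypothesis FA : forall a b c, F ((a * F (a, b))%g, c) = F (a, F (b, c)).

Lemma inner_derivative_comp a b z :
  inner_derivative F (a * F (a, b))%g z = inner_derivative F a (inner_derivative F b z).
Proof.
have ez := (lie_exp_curve z).2.
have A := inner_velocity sF F1r a (inner_velocity sF F1r b ez).
have B := inner_velocity sF F1r (a * F (a, b))%g ez.
apply: has_velocity_unique B _.
by under eq_fun do rewrite FA.
Qed.

Let T := mixed_derivative F.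
(** At [(phi G a, e)], for [a] in the chart at the unit, this is [inner_derivative F a z]; unlike
    the latter it is a function on an open subset of a vector space, hence can be differentiated
    twice. *)
Let h z p := 'D_(0, z) (chart_expr F) p.

Let We : chart_expr_dom F (e, e).
Proof. exact/chart_expr_dom1/chart_dom. Qed.

Let hk z : ck_on 2 (chart_expr_dom F) (h z).
Proof. exact: (ck_on_chart_expr sF 3).2. Qed.

Lemma mixed_derivative_chart x z : 'D_(x, 0) (h z) (e, e) = T x z.
Proof. by rewrite /T mixed_derivativeE. Qed.

(* The velocity of [b |-> a * F (a, b)] at [b = 1] in the direction [y]. *)
Definition translated_velocity a y := 'D_(0, inner_derivative F a y) mulhat (phi G a, e).

(* The derivative of [A (a * F (a, b)) z = A a (A b z)] at [b = 1], where [A] is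
   [inner_derivative F]. *)
Lemma derive_translated a y z : cdom (mfd_chart (1%g : G)) a ->
  'D_(translated_velocity a y, 0) (h z) (phi G a, e) = inner_derivative F a (T y z).
Proof.
move=> Aa; have ey := (lie_exp_curve y).2; have A1 := chart_dom (1%g : G).
have [q0 qc dq] := inner_velocity sF F1r a ey.
pose q (s : R) := F (a, lie_exp (s *: y)).
pose r s := (a * q s)%g.
have kc : {for 0, continuous (cst a : R -> G)} by exact: cvg_cst.
have kd := is_derive_cst (phi G a) (0 : R) 1.
have dr : is_derive (0 : R) 1 (fun s => phi G (r s)) (translated_velocity a y).
  have := is_derive_bicurve smul kc qc; rewrite /mul_pair /= q0 mulg1.
  by move=> /(_ 0 _ Aa A1 Aa kd dq).
have r0 : r 0 = a by rewrite /r /q q0 mulg1.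
have rc : {for 0, continuous r}.
  exact: (@continuous_comp _ _ _ q (fun g => a * g)%g 0 qc ((smooth_map_mulgl a).1 _)).
have near_r : \forall s \near (0 : R), cdom (mfd_chart (1%g : G)) (r s).
  by apply: (rc (cdom (mfd_chart (1%g : G)))); rewrite r0; exact: chart_near.
have Wa : chart_expr_dom F (phi G (r 0), e) by rewrite r0; exact: chart_expr_dom1.
have dp : is_derive (0 : R) 1 (fun s => (phi G (r s), e)) (translated_velocity a y, 0).
  by apply: is_derive_pair dr _; exact: (is_derive_cst e (0 : R) 1).
have dh := is_derive_comp_curve ((hk z).1 _ Wa) dp.
have dL : is_derive (0 : R) 1 (fun s => inner_derivative F (r s) z)
    ('D_(translated_velocity a y, 0) (h z) (phi G (r 0), e)).
  apply: near_eq_is_derive dh.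
  by apply: filterS near_r => s As; rewrite /= (inner_derivativeE sF F1r).
(* On the right side of the identity, the linear map [inner_derivative F a] passes through the
   derivative in [b]. *)
pose I : {linear _ -> _} := HB.pack (inner_derivative F a)
  (GRing.isLinear.Build _ _ _ _ _ (inner_derivative_linear sF F1r a)).
have dR := is_derive_lin I (is_derive_mixed sF F1r z ey).
rewrite r0 in dL; apply: is_derive_unique dL _.
have -> // : (fun s => inner_derivative F (r s) z) =
    I \o (fun t : R => inner_derivative F (lie_exp (t *: y)) z).
by apply/funext => s; exact: inner_derivative_comp.
Qed.

(** The derivative of [derive_translated] along [a = exp (t x)]: the moving base point gives the
    second derivative of [h z], and the moving direction gives the term in [beta x y + T x y]. *)
Lemma mixed_derivative_comp x y z : T x (T y z) =
  'D_(x, 0) (fun p => 'D_(y, 0) (h z) p) (e, e) + T (beta x y + T x y) z.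
Proof.
have ex := (lie_exp_curve x).2.
pose c t := lie_exp (t *: x); have [c0 cc dc] : has_velocity c x := ex.
pose v t := inner_derivative F (c t) y.
have dv : is_derive (0 : R) 1 v (T x y) by exact: (is_derive_mixed sF F1r y ex).
have v0 : v 0 = y by rewrite /v c0; exact: inner_derivative1.
have Wm : chart_expr_dom mul_pair (e, e) by exact/mul_domr/chart_dom.
pose w t := translated_velocity (c t) y.
(* [beta x y] comes from the left factor moving along [x], and [T x y] from the change of the inner
   derivative of [y]. *)
have dw : is_derive (0 : R) 1 w (beta x y + T x y).
  have := is_derive_partialr smul Wm ex dv.
  by rewrite v0 derive_mulhat1r.
have w0 : w 0 = y.
  by rewrite /w /translated_velocity -/(v 0) v0 c0 derive_mulhat1r.
have dp : is_derive (0 : R) 1 (fun t => (phi G (c t), e)) (x, 0).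
  by apply: is_derive_pair dc _; exact: (is_derive_cst e (0 : R) 1).
have p0 : (phi G (c 0), e) = (e, e) by rewrite c0.
have := is_derive_derive_along (linl _ _ _) (open_chart_expr_dom sF) (hk z) _ dw dp.
rewrite /= p0 w0 => /(_ We) D1.
have D2 := is_derive_mixed sF F1r (T y z) ex.
rewrite (mixed_derivative_chart (beta x y + T x y) z) in D1.
have near_eq : \forall t \near (0 : R),
    'D_(w t, 0) (h z) (phi G (c t), e) = inner_derivative F (c t) (T y z).
  by apply: filterS (near_dom ex) => t At; exact: derive_translated.
exact: (is_derive_unique D2 (near_eq_is_derive near_eq D1)).
Qed.

Lemma mixed_derivative_curvature x y z :
  T (lie_bracket x y + T x y - T y x) z = T x (T y z) - T y (T x z).
Proof.
have [_ r] := mixed_derivative_bilinear sF F1r.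
pose L : {linear _ -> _} := HB.pack (T^~ z) (GRing.isLinear.Build _ _ _ _ _ (r z)).
have S := schwarz_rV (x, 0) (y, 0) (open_chart_expr_dom sF) (hk z) We.
(* Additive bookkeeping, stated over an abstract [zmodType]: [aux1] cancels the symmetric second
   derivatives in the difference of the two compositions, and [aux2] rearranges the argument of [T]
   once the bracket is [beta x y - beta y x]. *)
have aux1 (V : zmodType) (p q s s' a b c : V) :
    p = s + a -> q = s' + b -> s = s' -> c = a - b -> c = p - q.
  by move=> -> -> -> ->; rewrite opprD addrACA subrr add0r.
have aux2 (V : zmodType) (a b c d k : V) : a = b - c -> a + d - k = (b + d) - (c + k).
  by move=> ->; rewrite opprD addrA [b - c + d]addrAC.
have C := etrans (congr1 L (aux2 _ _ _ _ (T x y) (T y x) (lie_bracket_beta x y)))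
  (linearB L _ _).
exact: (aux1 _ _ _ _ _ _ _ _ (mixed_derivative_comp x y z)
  (mixed_derivative_comp y x z) S C).
Qed.

End Curvature.

End Bracket.

(** * Post-Lie groups and functoriality *)

Section PostLie.
Variable R : realType.

Definition rhd_pair (G : postLieGroupType R) (p : G * G) : G := rhd p.1 p.2.

Lemma post_lie_productE (G : postLieGroupType R) :
  @post_lie_product R G = mixed_derivative (@rhd_pair G).
Proof. by []. Qed.

Lemma smooth_rhd_pair (G : postLieGroupType R) :
  smooth_map (prod_atlas G.-atlas G.-atlas) G.-atlas (@rhd_pair G).
Proof. exact: rhd_smooth. Qed.

Lemma morph1g (G H : groupType) (f : G -> H) :
  {morph f : a b / (a * b)%g} -> f 1%g = 1%g.
Proof.
move=> fM; have := fM 1%g 1%g; rewrite mulg1 => /(congr1 (fun h => (f 1%g)^-1 * h)%g).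
by rewrite mulKg mulVg.
Qed.

Lemma rhd_pairg1 (G : postLieGroupType R) (a : G) : rhd_pair (a, 1%g) = 1%g.
Proof. exact: (morph1g (@rhdM G a)). Qed.

(** By [rhdA] and [rhd 1 1 = 1], the map [rhd 1] is idempotent; being injective, it is the
    identity. *)
Lemma rhd_pair1g (G : postLieGroupType R) (b : G) : rhd_pair (1%g, b) = b.
Proof.
have /bij_inj rI := @rhd_bij G 1%g; apply: rI.
have r11 : rhd (1%g : G) 1%g = 1%g := rhd_pairg1 1%g.
by rewrite /rhd_pair /= -rhdA r11 mulg1.
Qed.

Lemma post_lie_group_algebra (G : postLieGroupType R) :
  is_post_lie_algebra (@lie_bracket R G) (@post_lie_product R G).
Proof.
have FA (a b c : G) :
    rhd_pair ((a * rhd_pair (a, b))%g, c) = rhd_pair (a, rhd_pair (b, c)).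
  exact: rhdA.
have FM (a b c : G) : rhd_pair (a, (b * c)%g) = (rhd_pair (a, b) * rhd_pair (a, c))%g.
  exact: rhdM.
have sF := @smooth_rhd_pair G.
rewrite post_lie_productE; split.
- exact: lie_bracket_lie_algebra.
- exact: (mixed_derivative_bilinear sF (@rhd_pairg1 G)).
- exact: (mixed_derivative_bracket sF FM (@rhd_pairg1 G) (@rhd_pair1g G)).
- exact: (mixed_derivative_curvature sF (@rhd_pairg1 G) (@rhd_pair1g G) FA).
Qed.

Lemma post_lie_group_hom_tangent (G H : postLieGroupType R) (Psi : G -> H) :
  is_post_lie_group_hom Psi ->
  is_post_lie_algebra_hom (@lie_bracket R G) (@post_lie_product R G)
    (@lie_bracket R H) (@post_lie_product R H) (tangent_map Psi 1%g).
Proof.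
move=> [sP PM Pr]; have P1 := morph1g PM.
have PV a : Psi a^-1%g = (Psi a)^-1%g by apply/esym/mulg1_eq; rewrite -PM mulgV.
rewrite !post_lie_productE.
split=> [k x y|x y|x y]; first by rewrite /tangent_map linearP.
- rewrite !lie_bracketE.
  apply: (mixed_derivative_hom (@smooth_conj_pair R G) (@smooth_conj_pair R H)
    (@conj_pair1 R G) (@conj_pair1 R H) sP P1) => a b.
  by rewrite /conj_pair /= !PM PV.
- exact: (mixed_derivative_hom (@smooth_rhd_pair G) (@smooth_rhd_pair H)
    (@rhd_pairg1 G) (@rhd_pairg1 H) sP P1 Pr).
Qed.

Lemma tangent_map_id (G : lieGroupType R) : tangent_map (@id G) 1%g = id.
Proof.
apply/funext => x; have ex := (lie_exp_curve x).2.
have sid := smooth_map_id (@mfd_chartP R G).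
exact: has_velocity_unique (tangent_map_velocity sid erefl ex) ex.
Qed.

(** Both sides are the velocity of the image under [g \o f] of the exponential curve of [x]. *)
Lemma tangent_map_comp (G H K : lieGroupType R) (g : H -> K) (f : G -> H) :
  smooth_map H.-atlas K.-atlas g -> smooth_map G.-atlas H.-atlas f ->
  g 1%g = 1%g -> f 1%g = 1%g ->
  tangent_map (g \o f) 1%g = tangent_map g 1%g \o tangent_map f 1%g.
Proof.
move=> sg sf g1 f1; apply/funext => x; have ex := (lie_exp_curve x).2.
have sgf : smooth_map G.-atlas K.-atlas (g \o f).
  by apply: smooth_map_comp sf sg; exact: mfd_chartP.
have gf1 : (g \o f) 1%g = 1%g by rewrite /= f1.
exact: (has_velocity_unique (tangent_map_velocity sgf gf1 ex)
  (tangent_map_velocity sg g1 (tangent_map_velocity sf f1 ex))).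
Qed.

End PostLie.

Theorem theorem4p3 (R : realType) :
  exists (algP : forall G : postLieGroupType R,
            is_post_lie_algebra (@lie_bracket R G) (@post_lie_product R G))
         (homP : forall (G H : postLieGroupType R) (Psi : G -> H),
            is_post_lie_group_hom Psi ->
            is_post_lie_algebra_hom (@lie_bracket R G) (@post_lie_product R G)
              (@lie_bracket R H) (@post_lie_product R H)
              (tangent_map Psi 1%g)),
    @is_functor (PostLieGroups R) (PostLieAlgebras R)
      (fun G => PostLieAlgebra (algP G))
      (fun G H Psi =>
         @PostLieAlgebraHom R (PostLieAlgebra (algP G)) (PostLieAlgebra (algP H))
           (tangent_map (plg_fun Psi) 1%g) (homP G H Psi (plg_funP Psi))).
Proof.
exists (@post_lie_group_algebra R), (@post_lie_group_hom_tangent R).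
(* Morphisms with the same underlying function are equal, so the functor laws become identities
   between tangent maps. *)
split=> [G|G H K g f]; apply: pla_hom_eq; first exact: tangent_map_id.
have [sg gM _] := plg_funP g; have [sf fM _] := plg_funP f.
exact: tangent_map_comp sg sf (morph1g gM) (morph1g fM).
Qed.
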